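(* Let $\mathcal{A}$ be an Arens regular Banach algebra such that $\mathcal{A}^{**}$ is approximately Connes-amenable. (i) If $\mathcal{A}$ is a dual Banach algebra, then $\mathcal{A}$ is approximately Connes-amenable. (ii) If $\mathcal{A}$ is an ideal in $\mathcal{A}^{**}$ and $\mathcal{A}^{**}$ has an identity, then $\mathcal{A}$ is approximately amenable.
   Context: Derivations are bounded. For a Banach $\mathcal{B}$-bimodule $\mathcal{X}$, the dual $\mathcal{X}^*$ is a bimodule via $\langle \phi.a,x\rangle=\langle\phi,a.x\rangle$, $\langle a.\phi,x\rangle=\langle\phi,x.a\rangle$; a dual Banach bimodule is one of the form $\mathcal{X}=(\mathcal{X}_* )^*$ for a Banach bimodule $\mathcal{X}_*$. A Banach algebra $\mathcal{B}$ is a dual Banach algebra if there is a closed submodule $\mathcal{B}_*$ of $\mathcal{B}^*$ with $\mathcal{B}=(\mathcal{B}_* )^*$; the predual is fixed, and $\omega^*$ on $\mathcal{B}$ means $\sigma(\mathcal{B},\mathcal{B}_* )$. The first Arens product on $\mathcal{A}^{**}$ is $\langle m.n,f\rangle=\langle m,n.f\rangle$ with $\langle n.f,a\rangle=\langle n,f.a\rangle$; the second is $\langle m\Box n,f\rangle=\langle n,f\Box m\rangle$ with $\langle f\Box m,a\rangle=\langle m,a.f\rangle$ ($f\in\mathcal{A}^*$, $m,n\in\mathcal{A}^{**}$, $a\in\mathcal{A}$). $\mathcal{A}$ is Arens regular if these coincide; then $\mathcal{A}^{**}$ is a dual Banach algebra with predual $\mathcal{A}^*$, and it is considered as such. $\mathcal{A}$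 is identified with its canonical image in $\mathcal{A}^{**}$. A dual Banach $\mathcal{B}$-bimodule $\mathcal{X}$ over a dual Banach algebra $\mathcal{B}$ is normal if for every $x\in\mathcal{X}$ the maps $a\mapsto a.x$ and $a\mapsto x.a$ from $\mathcal{B}$ to $\mathcal{X}$ are $\omega^*$-$\omega^*$ continuous. A derivation $D:\mathcal{B}\to\mathcal{X}$ is approximately inner if there is a (not necessarily bounded) net $(x_\alpha)\subseteq\mathcal{X}$ with $D(a)=\lim_\alpha(a.x_\alpha-x_\alpha.a)$ in norm for every $a\in\mathcal{B}$. A dual Banach algebra $\mathcal{B}$ is approximately Connes-amenable if for every normal dual Banach $\mathcal{B}$-bimodule $\mathcal{X}$, every $\omega^*$-$\omega^*$ continuous derivation $D:\mathcal{B}\to\mathcal{X}$ is approximately inner. A Banach algebra $\mathcal{B}$ is approximately amenable if for every Banach $\mathcal{B}$-bimodule $\mathcal{X}$, every derivation $D:\mathcal{B}\to\mathcal{X}^*$ is approximately inner. *)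

(* Defs.v *)
From HB Require Import structures.
From mathcomp Require Import all_boot all_order all_algebra.
From mathcomp Require Import all_classical all_reals all_analysis.
From mathcomp Require Import complex.

Set Implicit Arguments.
Unset Strict Implicit.
Unset Printing Implicit Defensive.

Import Order.TTheory GRing.Theory Num.Theory numFieldNormedType.Exports.

Local Open Scope classical_set_scope.
Local Open Scope ring_scope.
Local Open Scope complex_scope.

(* The scalar field is R[i]; its norm takes values in the nonnegative reals   *)
(* of R[i].  Seen as a normed space over itself it is written R[i]^o.         *)

Definition bounded_map (R : realType) (V W : normedModType R[i]) (f : V -> W) :=
  exists k : R[i], forall x, `|f x| <= k * `|x|.

Section dual_space.
Context (R : realType) (V : normedModType R[i]).

Definition bounded_functional : {pred V -> R[i]^o} :=
  fun f => `[< linear f /\ bounded_map f >].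

Lemma bounded_functionalP f :
  reflect (linear f /\ bounded_map f) (f \in bounded_functional).
Proof. exact: asboolP. Qed.

Lemma bounded_functional_submod_closed : submod_closed bounded_functional.
Proof.
split.
  apply/bounded_functionalP; split; first by move=> a x y /=; rewrite scaler0 addr0.
  by exists 0 => x; rewrite normr0 mul0r.
move=> c f g /bounded_functionalP[lf [k kf]] /bounded_functionalP[lg [l lg']]; apply/bounded_functionalP; split.
  move=> a x y; have fgE z : (c *: f + g) z = c *: f z + g z by [].
  rewrite !fgE lf lg !scalerDr !scalerA.
  by rewrite (mulrC c a) -!scalerA addrACA.
exists (`|c| * k + l) => x.
rewrite mulrDl (le_trans (ler_normD _ _))// lerD//.
by rewrite normrZ -mulrA ler_wpM2l.
Qed.

HB.instance Definition _ := GRing.isSubmodClosed.Build R[i] (V -> R[i]^o)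
  bounded_functional bounded_functional_submod_closed.

Record dual := Dual {
  dual_fun :> V -> R[i]^o ;
  dual_funP : dual_fun \in bounded_functional }.

HB.instance Definition _ := [isSub for dual_fun].
HB.instance Definition _ := [Choice of dual by <:].
HB.instance Definition _ := [SubChoice_isSubLmodule of dual by <:].

Definition dual_of (f : V -> R[i]^o) (lf : linear f) (bf : bounded_map f) : dual :=
  Dual (asboolT (conj lf bf)).

Lemma dual_linear (f : dual) : linear f.
Proof. by have /bounded_functionalP[] := dual_funP f. Qed.

HB.instance Definition _ (f : dual) :=
  GRing.isLinear.Build R[i] V R[i]^o *:%R (dual_fun f) (dual_linear f).

Lemma dualE (f g : dual) : f =1 g -> f = g.
Proof. by move=> fg; apply/val_inj/funext. Qed.

Definition dual_norm (f : dual) : R[i] :=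
  (sup [set complex.Re `|f x| | x in [set x : V | `|x| <= 1]])%:C.

Lemma dual_norm_ubound (f : dual) x : `|f x| <= dual_norm f * `|x|.
Proof.
have /bounded_functionalP[_ [k kf]] := dual_funP f.
have reC (y : R[i]) : (complex.Re `|y|)%:C = `|y| by rewrite RRe_real// normr_real.
have reV (y : V) : (complex.Re `|y|)%:C = `|y| by rewrite RRe_real// normr_real.
have [->|x0] := eqVneq x 0; first by rewrite raddf0 !normr0 mulr0.
have nx0 : 0 < `|x| by rewrite normr_gt0.
rewrite -ler_pdivrMr//.
have -> : `|f x| / `|x| = `|f (`|x|^-1 *: x)|.
  by rewrite linearZ/= normrZ normfV normr_id mulrC.
rewrite -reC lecR; apply: ub_le_sup; last first.
  exists (`|x|^-1 *: x) => //=.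
  by rewrite normrZ normfV normr_id mulVf// gt_eqF.
exists (complex.Re `|k|) => _ /= [y y1 <-]; rewrite -lecR !reC.
rewrite (le_trans (kf y))// (@le_trans _ _ (`|k| * `|y|))//; last first.
  by rewrite ler_piMr.
have [y0|y0] := eqVneq `|y| 0; first by rewrite y0 !mulr0.
have ny0 : 0 < `|y| by rewrite lt_def y0/=.
have k0 : 0 <= k.
  by rewrite -(pmulr_lge0 k ny0) (le_trans _ (kf y)).
by rewrite ger0_norm.
Qed.

Lemma dual_norm_le (f : dual) (M : R[i]) : 0 <= M ->
  (forall x, `|f x| <= M * `|x|) -> dual_norm f <= M.
Proof.
move=> M0 fM.
have reC (y : R[i]) : (complex.Re `|y|)%:C = `|y| by rewrite RRe_real// normr_real.
have ReM : M = (complex.Re M)%:C by rewrite RRe_real// ger0_real.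
rewrite ReM lecR; apply: ge_sup.
  by exists (complex.Re `|f 0|); exists 0 => //=; rewrite normr0.
move=> _ /= [y y1 <-]; rewrite -lecR reC -ReM (le_trans (fM y))//.
by rewrite ler_piMr.
Qed.

Lemma dual_norm_ge0 (f : dual) : 0 <= dual_norm f.
Proof.
have reC (y : R[i]) : (complex.Re `|y|)%:C = `|y| by rewrite RRe_real// normr_real.
rewrite /dual_norm ler0c.
have [hs|/sup_out ->//] := pselect (has_sup
  [set complex.Re `|f x| | x in [set x : V | `|x| <= 1]]).
apply: (@le_trans _ _ (complex.Re `|f 0|)); first by rewrite -ler0c reC.
by apply: sup_upper_bound => //; exists 0 => //=; rewrite normr0.
Qed.

Lemma dual_normD (f g : dual) : dual_norm (f + g) <= dual_norm f + dual_norm g.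
Proof.
apply: dual_norm_le; first by rewrite addr_ge0// dual_norm_ge0.
move=> x; rewrite (le_trans (ler_normD (f x) (g x)))// mulrDl lerD//.
  exact: dual_norm_ubound.
exact: dual_norm_ubound.
Qed.

Lemma dual_normZ_le (a : R[i]) (f : dual) : dual_norm (a *: f) <= `|a| * dual_norm f.
Proof.
apply: dual_norm_le; first by rewrite mulr_ge0// dual_norm_ge0.
move=> x; have -> : (a *: f) x = a *: f x by [].
by rewrite normrZ -mulrA ler_wpM2l// dual_norm_ubound.
Qed.

Lemma dual_normZ (a : R[i]) (f : dual) : dual_norm (a *: f) = `|a| * dual_norm f.
Proof.
apply/eqP; rewrite eq_le dual_normZ_le/=.
have [->|a0] := eqVneq a 0; first by rewrite normr0 mul0r dual_norm_ge0.
have := dual_normZ_le a^-1 (a *: f).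
by rewrite scalerA mulVf// scale1r normfV ler_pdivlMl// normr_gt0.
Qed.

Lemma dual_norm0_eq0 (f : dual) : dual_norm f = 0 -> f = 0.
Proof.
move=> f0; apply: dualE => x; apply/eqP; rewrite -normr_le0.
by rewrite (le_trans (dual_norm_ubound f x))// f0 mul0r.
Qed.

HB.instance Definition _ := Lmodule_isNormed.Build R[i] dual
  dual_normD dual_normZ dual_norm0_eq0.

Lemma dual_le (f : dual) x : `|f x| <= `|f| * `|x|.
Proof. exact: dual_norm_ubound. Qed.

Lemma dual_leP (f : dual) (M : R[i]) : 0 <= M ->
  (forall x, `|f x| <= M * `|x|) -> `|f| <= M.
Proof. exact: dual_norm_le. Qed.

End dual_space.

Section dual_complete.
Context (R : realType).

Lemma complex_cauchy_cvg (F : set_system R[i]^o) : ProperFilter F ->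
  cauchy F -> cvg F.
Proof.
move=> FF Fc.
have Fe (e : R) : 0 < e -> exists z : R[i], F [set w | `|w - z| < e%:C].
  move=> e0; have /cauchyP/(_ e%:C) := Fc; rewrite ltcR => /(_ e0)[z zF].
  by exists z; apply: filterS zF => w; rewrite -ball_normE /= distrC.
have reim (p : R[i] -> R) (pB : forall x y, p x - p y = p (x - y))
    (ple : forall x, `|p x|%:C <= `|x|) : cvg (p @ F).
  apply: cauchy_cvg; apply/cauchyP => e e0.
  have [z zF] := Fe _ e0; exists (p z).
  change (F (p @^-1` ball (p z) e)); apply: filterS zF => w wz.
  rewrite /preimage/= -ball_normE/=.
  by rewrite distrC pB -ltcR (le_lt_trans (ple _)).
have ReB (x y : R[i]) : complex.Re x - complex.Re y = complex.Re (x - y).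
  by case: x y => [? ?] [].
have ImB (x y : R[i]) : complex.Im x - complex.Im y = complex.Im (x - y).
  by case: x y => [? ?] [].
have Imle (x : R[i]) : `|complex.Im x|%:C <= `|x|.
  rewrite normc_def lecR -sqrtr_sqr ler_sqrt ?addr_ge0 ?sqr_ge0//.
  by rewrite lerDr sqr_ge0.
have /cvg_ex[a Fa] := reim _ ReB (@normc_ge_Re R).
have /cvg_ex[b Fb] := reim _ ImB Imle.
apply/cvg_ex; exists (a +i* b).
apply/cvgrPdist_lt => e e0.
have eE : e = (complex.Re e)%:C by rewrite RRe_real// gtr0_real.
have e20 : 0 < complex.Re e / 2 by rewrite divr_gt0// -ltcR -eE.
move/cvgrPdist_lt/(_ _ e20) : Fa => Fa; move/cvgrPdist_lt/(_ _ e20) : Fb => Fb.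
near=> z.
have -> : a +i* b - z = (a - complex.Re z)%:C + 'i * (b - complex.Im z)%:C.
  have -> : a +i* b - z = (a - complex.Re z) +i* (b - complex.Im z).
    by case: (z).
  exact: complexE.
rewrite (le_lt_trans (ler_normD _ _))// normrM.
have -> : `|'i : R[i]| = 1 by rewrite normc_def/= expr0n/= expr1n add0r sqrtr1.
have nR (r : R) : `|r%:C| = `|r|%:C by rewrite normc_def/= expr0n/= addr0 sqrtr_sqr.
rewrite mul1r !nR -rmorphD/= eE ltcR [ltRHS]splitr ltrD//.
  by near: z.
by near: z.
Unshelve. all: by end_near. Qed.

Context (V : normedModType R[i]).

Lemma dual_cauchy_cvg (F : set_system (dual V)) : ProperFilter F ->
  cauchy F -> cvg F.
Proof.
move=> FF Fc.
have Fe (e : R[i]) : 0 < e -> exists f : dual V, F [set g | `|g - f| < e].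
  move=> e0; have /cauchyP/(_ e) := Fc => /(_ e0)[z zF].
  by exists z; apply: filterS zF => w; rewrite -ball_normE /= distrC.
have Fx (x : V) : cvg ((fun f : dual V => f x : R[i]^o) @ F).
  apply: complex_cauchy_cvg; apply/cauchyP => e e0.
  have x1 : 0 < `|x| + 1 by rewrite ltr_wpDl.
  have [f fF] := Fe (e / (`|x| + 1)) (divr_gt0 e0 x1).
  exists (f x); change (F ((fun f : dual V => f x : R[i]^o) @^-1` ball (f x : R[i]^o) e)).
  apply: filterS fF => g /= gf.
  rewrite /preimage/= -ball_normE/= distrC.
  have -> : g x - f x = (g - f) x by [].
  rewrite (le_lt_trans (dual_le _ _))//.
  rewrite (@le_lt_trans _ _ (`|g - f| * (`|x| + 1)))//.
    by rewrite ler_wpM2l// lerDl.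
  by rewrite -ltr_pdivlMr.
pose h (x : V) : R[i]^o := lim ((fun f : dual V => f x : R[i]^o) @ F).
have hF x : (fun f : dual V => f x : R[i]^o) @ F --> h x by exact: Fx.
have hl : linear h.
  move=> a x y.
  have : (fun f : dual V => a *: f x + f y : R[i]^o) @ F --> (a *: h x + h y : R[i]^o).
    by apply: cvgD => //; exact: cvgZl_tmp.
  rewrite (_ : (fun f : dual V => _) = (fun f : dual V => f (a *: x + y) : R[i]^o)).
    by move=> H; apply: (norm_cvg_unique (hF _) H).
  by apply/funext => f; rewrite dual_linear.
have key (e : R[i]) f : F [set g | `|g - f| < e] -> forall x, `|h x - f x| <= e * `|x|.
  move=> fF x.
  have fx_real : `|h x - f x| \is Num.real by rewrite normr_real.
  have ex_real : e * `|x| \is Num.real.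
    have /filter_ex[g /= ge] := fF.
    by rewrite realM// ger0_real// ?normr_ge0// (le_trans _ (ltW ge)).
  rewrite real_leNgt//; apply/negP => ltd.
  have d0 : 0 < `|h x - f x| - e * `|x| by rewrite subr_gt0.
  have /cvgrPdist_lt/(_ _ d0) hFd := hF x.
  have /filter_ex[g /= [gd ge]] : F ([set g : dual V | `|h x - g x| < `|h x - f x| - e * `|x|] `&` [set g | `|g - f| < e]) by exact: filterI.
  suff : `|h x - f x| < `|h x - f x| by rewrite ltxx.
  rewrite {1}(_ : h x - f x = (h x - g x) + (g - f) x); last first.
    by rewrite -[(g - f) x]/(g x - f x) addrA subrK.
  rewrite (le_lt_trans (ler_normD _ _))//.
  rewrite -[ltRHS](subrK (e * `|x|)) ltr_leD//.
  by rewrite (le_trans (dual_le _ _))// ler_wpM2r// ltW.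
have [f0 f0F] := Fe 1 ltr01.
have hb : bounded_map h.
  exists (1 + `|f0|) => x.
  rewrite -(subrK (f0 x) (h x)) (le_trans (ler_normD _ _))// mulrDl lerD//.
    exact: key.
  exact: dual_le.
apply/cvg_ex; exists (dual_of hl hb); apply/cvgrPdist_lt => e e0.
have e20 : 0 < e / 2 by rewrite divr_gt0.
have [f fF] := Fe _ e20.
apply: filterS (fF) => g /= gf.
rewrite -(subrK f (dual_of hl hb)) -addrA (le_lt_trans (ler_normD _ _))//.
rewrite [ltRHS]splitr ler_ltD//; last by rewrite distrC.
by apply: dual_leP; [exact: ltW|exact: key].
Qed.

HB.instance Definition _ := Uniform_isComplete.Build (dual V) dual_cauchy_cvg.

End dual_complete.

Section weak_star.
Context (R : realType).

(* The canonical embedding of V into its bidual. *)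
Definition canon (V : normedModType R[i]) (x : V) : dual (dual V).
Proof.
apply: (@dual_of _ _ (fun f : dual V => f x)); first by [].
by exists `|x| => f; rewrite mulrC dual_le.
Defined.

Lemma canon_norm (V : normedModType R[i]) (x : V) : `|canon x| <= `|x|.
Proof. by apply: dual_leP => // f; rewrite mulrC; exact: dual_le. Qed.

Lemma canon_linear (V : normedModType R[i]) : linear (@canon V).
Proof. by move=> c x y; apply: dualE => f /=; rewrite dual_linear. Qed.

HB.instance Definition _ (V : normedModType R[i]) :=
  GRing.isLinear.Build R[i] V (dual (dual V)) *:%R (@canon V) (@canon_linear V).

(* The topology sigma(V, P) on V. *)
Definition weak_star (V : normedModType R[i]) (P : set (dual V)) :
    topologicalType := initial_topology
    ((fun x (f : P) => \val f x) : V -> {ptws P -> R[i]^o}).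

Definition weak_star_continuous (V W : normedModType R[i])
    (P : set (dual V)) (Q : set (dual W)) (T : V -> W) :=
  continuous (T : weak_star P -> weak_star Q).

End weak_star.

Record banachAlgebra (R : realType) := BanachAlgebra {
  ba_space :> completeNormedModType R[i] ;
  ba_mul : ba_space -> ba_space -> ba_space ;
  ba_mull_linear : forall b, linear (ba_mul^~ b) ;
  ba_mulr_linear : forall a, linear (ba_mul a) ;
  ba_mulA : associative ba_mul ;
  ba_norm_mul : forall a b, `|ba_mul a b| <= `|a| * `|b| }.

Record banachBimodule (R : realType) (B : banachAlgebra R) := BanachBimodule {
  bm_space :> completeNormedModType R[i] ;
  lact : B -> bm_space -> bm_space ;
  ract : bm_space -> B -> bm_space ;
  lact_linearl : forall x, linear (lact^~ x) ;
  lact_linearr : forall a, linear (lact a) ;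
  ract_linearl : forall a, linear (ract^~ a) ;
  ract_linearr : forall x, linear (ract x) ;
  lactA : forall a b x, lact a (lact b x) = lact (ba_mul a b) x ;
  ractA : forall x a b, ract (ract x a) b = ract x (ba_mul a b) ;
  lractA : forall a x b, ract (lact a x) b = lact a (ract x b) ;
  lact_bounded : exists k : R[i], forall a x, `|lact a x| <= k * `|a| * `|x| ;
  ract_bounded : exists k : R[i], forall x a, `|ract x a| <= k * `|x| * `|a| }.

Section bimodules.
Context (R : realType) (B : banachAlgebra R).

Definition regular_bimodule : banachBimodule B.
Proof.
refine (@BanachBimodule R B B (@ba_mul R B) (@ba_mul R B)
  (@ba_mull_linear R B) (@ba_mulr_linear R B) (@ba_mull_linear R B)
  (@ba_mulr_linear R B) (@ba_mulA R B) _ _ _ _).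
- by move=> *; rewrite ba_mulA.
- by move=> *; rewrite ba_mulA.
- by exists 1 => a b; rewrite mul1r ba_norm_mul.
- by exists 1 => a b; rewrite mul1r ba_norm_mul.
Defined.

Context (X : banachBimodule B).

Lemma lact_dual_bounded (phi : dual X) a : bounded_map (fun x => phi (lact a x)).
Proof.
have [k ka] := lact_bounded X; exists (`|phi| * (k * `|a|)) => x.
by rewrite (le_trans (dual_le _ _))// -mulrA ler_wpM2l.
Qed.

Lemma ract_dual_bounded (phi : dual X) a : bounded_map (fun x => phi (ract x a)).
Proof.
have [k ka] := ract_bounded X; exists (`|phi| * (k * `|a|)) => x.
by rewrite (le_trans (dual_le _ _))// -mulrA ler_wpM2l// mulrAC.
Qed.

Lemma lact_dual_linear (phi : dual X) a :
  linear (fun x => phi (lact a x) : R[i]^o).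
Proof. by move=> c x y; rewrite lact_linearr dual_linear. Qed.

Lemma ract_dual_linear (phi : dual X) a :
  linear (fun x => phi (ract x a) : R[i]^o).
Proof. by move=> c x y; rewrite ract_linearl dual_linear. Qed.

(* <phi.a, x> = <phi, a.x> *)
Definition dual_ract (phi : dual X) (a : B) : dual X :=
  dual_of (lact_dual_linear phi a) (lact_dual_bounded phi a).

(* <a.phi, x> = <phi, x.a> *)
Definition dual_lact (a : B) (phi : dual X) : dual X :=
  dual_of (ract_dual_linear phi a) (ract_dual_bounded phi a).

Lemma dual_ract_bounded :
  exists k : R[i], forall phi a, `|dual_ract phi a| <= k * `|phi| * `|a|.
Proof.
have [k ka] := lact_bounded X; exists `|k| => phi a.
apply: dual_leP => [|x]; first by rewrite !mulr_ge0.
rewrite (le_trans (dual_le phi _))//.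
rewrite (_ : `|k| * `|phi| * `|a| * `|x| = `|phi| * (`|k| * `|a| * `|x|)).
  rewrite ler_wpM2l//; have := ka a x.
  have [->|a0] := eqVneq `|a| 0; first by rewrite !(mulr0, mul0r).
  have [->|x0] := eqVneq `|x| 0; first by rewrite !(mulr0, mul0r).
  have ax : 0 < `|a| * `|x| by rewrite mulr_gt0// lt_def ?a0 ?x0/=.
  move=> H; rewrite (le_trans H)// -!mulrA ler_wpM2r ?(ltW ax)//.
  have k0 : 0 <= k by rewrite -(pmulr_lge0 k ax) mulrA (le_trans _ H).
  by rewrite ger0_norm.
by rewrite -!mulrA mulrCA.
Qed.

Lemma dual_lact_bounded :
  exists k : R[i], forall a phi, `|dual_lact a phi| <= k * `|a| * `|phi|.
Proof.
have [k ka] := ract_bounded X; exists `|k| => a phi.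
apply: dual_leP => [|x]; first by rewrite !mulr_ge0.
rewrite (le_trans (dual_le phi _))//.
rewrite (_ : `|k| * `|a| * `|phi| * `|x| = `|phi| * (`|k| * (`|x| * `|a|))).
  rewrite ler_wpM2l//; have := ka x a; rewrite -mulrA.
  have [->|a0] := eqVneq `|a| 0; first by rewrite !(mulr0, mul0r).
  have [->|x0] := eqVneq `|x| 0; first by rewrite !(mulr0, mul0r).
  have ax : 0 < `|x| * `|a| by rewrite mulr_gt0// lt_def ?a0 ?x0/=.
  move=> H; rewrite (le_trans H)// ler_wpM2r ?(ltW ax)//.
  have k0 : 0 <= k by rewrite -(pmulr_lge0 k ax) (le_trans _ H).
  by rewrite ger0_norm.
by rewrite [RHS]mulrC -!mulrA; congr (_ * _); rewrite mulrA mulrC.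
Qed.

Definition dual_bimodule : banachBimodule B.
Proof.
refine (@BanachBimodule R B (dual X) dual_lact dual_ract
  _ _ _ _ _ _ _ dual_lact_bounded dual_ract_bounded).
- by move=> phi c a b; apply: dualE => x /=; rewrite ract_linearr dual_linear.
- by move=> a c phi psi; apply: dualE.
- by move=> a c phi psi; apply: dualE.
- by move=> phi c a b; apply: dualE => x /=; rewrite lact_linearl dual_linear.
- by move=> a b phi; apply: dualE => x /=; rewrite ractA.
- by move=> phi a b; apply: dualE => x /=; rewrite lactA.
- by move=> a phi b; apply: dualE => x /=; rewrite lractA.
Defined.

Definition derivation (D : B -> X) :=
  [/\ linear D, bounded_map D &
      forall a b, D (ba_mul a b) = lact a (D b) + ract (D a) b].

End bimodules.

Section approximately_inner.

Definition directed (I : Type) (le : I -> I -> Prop) :=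
  [/\ inhabited I, forall i, le i i,
      forall i j k, le i j -> le j k -> le i k &
      forall i j, exists2 k, le i k & le j k].

Definition tails (I : Type) (le : I -> I -> Prop) : set_system I :=
  filter_from [set: I] (fun i => [set j | le i j]).

Definition approximately_inner (R : realType) (B : banachAlgebra R)
    (X : banachBimodule B) (D : B -> X) :=
  exists (I : Type) (le : I -> I -> Prop) (x : I -> X), directed le /\
    forall a, (fun i => lact a (x i) - ract (x i) a) @ tails le --> D a.

End approximately_inner.

Definition approximately_amenable (R : realType) (B : banachAlgebra R) :=
  forall (X : banachBimodule B) (D : B -> dual_bimodule X),
    derivation D -> approximately_inner D.

(* P is a predual of B: a closed submodule of the dual of B for which the     *)
(* canonical map from B to the dual of P is an isomorphism of Banach spaces   *)
(* (onto and bounded below; it is always linear and contractive).             *)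
Record is_predual (R : realType) (B : banachAlgebra R)
    (P : set (dual_bimodule (regular_bimodule B))) : Prop := IsPredual {
  predual_closed : closed P ;
  predual0 : P 0 ;
  predual_linear : forall (c : R[i]) f g, P f -> P g -> P (c *: f + g) ;
  predual_lact : forall a f, P f -> P (lact a f) ;
  predual_ract : forall f a, P f -> P (ract f a) ;
  predual_onto : forall phi : dual B -> R[i]^o,
    (forall (c : R[i]) f g, P f -> P g -> phi (c *: f + g) = c *: phi f + phi g) ->
    (exists k : R[i], forall f, P f -> `|phi f| <= k * `|f|) ->
    exists b : B, forall f : dual B, P f -> phi f = f b ;
  predual_below : exists k : R[i], forall (b : B) (M : R[i]), 0 <= M ->
    (forall f : dual B, P f -> `|f b| <= M * `|f|) -> `|b| <= k * M }.

Record dualBanachAlgebra (R : realType) := DualBanachAlgebra {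
  dba_algebra :> banachAlgebra R ;
  predual : set (dual dba_algebra) ;
  predualP : is_predual predual }.

Section Connes_amenability.
Context (R : realType) (B : dualBanachAlgebra R).

(* The dual Banach bimodule is the dual of X, with predual the image of X.    *)
Definition normal_dual (X : banachBimodule B) :=
  forall phi : dual_bimodule X,
    weak_star_continuous (@predual _ B) (range (@canon R X))
      (fun a => lact a phi) /\
    weak_star_continuous (@predual _ B) (range (@canon R X))
      (fun a => ract phi a).

Definition approximately_Connes_amenable :=
  forall X : banachBimodule B, normal_dual X ->
  forall D : B -> dual_bimodule X, derivation D ->
    weak_star_continuous (@predual _ B) (range (@canon R X)) D ->
    approximately_inner D.

End Connes_amenability.

Section Arens.
Context (R : realType) (A : banachAlgebra R).
Local Notation A' := (dual A).
Local Notation A'' := (dual (dual A)).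
Local Notation reg := (regular_bimodule A).
Implicit Types (a : A) (f : A') (m n : A'').

Lemma regular_ract_le f a : `|dual_ract (X := reg) f a| <= `|f| * `|a|.
Proof.
apply: dual_leP => [|x]; first by rewrite mulr_ge0.
by rewrite (le_trans (dual_le f _))// -mulrA ler_wpM2l//= ba_norm_mul.
Qed.

Lemma regular_lact_le f a : `|dual_lact (X := reg) a f| <= `|f| * `|a|.
Proof.
apply: dual_leP => [|x]; first by rewrite mulr_ge0.
by rewrite (le_trans (dual_le f _))// -mulrA ler_wpM2l//= mulrC ba_norm_mul.
Qed.

Lemma arens_lmod_linear n f : linear (fun a => n (dual_ract (X := reg) f a)).
Proof.
move=> c a b; have /= -> := ract_linearr (b0 := dual_bimodule reg) f c a b.
by rewrite dual_linear.
Qed.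

Lemma arens_lmod_le n f a :
  `|n (dual_ract (X := reg) f a)| <= `|n| * `|f| * `|a|.
Proof.
by rewrite (le_trans (dual_le n _))// -mulrA ler_wpM2l// regular_ract_le.
Qed.

(* <n.f, a> = <n, f.a> *)
Definition arens_lmod n f : A' :=
  dual_of (arens_lmod_linear n f) (ex_intro _ (`|n| * `|f|) (arens_lmod_le n f)).

Lemma arens_lmod_norm n f : `|arens_lmod n f| <= `|n| * `|f|.
Proof. by apply: dual_leP => [|a]; [rewrite mulr_ge0|exact: arens_lmod_le]. Qed.

Lemma arens1_linear m n : linear (fun f => m (arens_lmod n f)).
Proof.
move=> c f g; rewrite -dual_linear; congr (m _); apply: dualE => a /=.
have /= -> := ract_linearl (b0 := dual_bimodule reg) a c f g.
by rewrite dual_linear.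
Qed.

Lemma arens1_le m n f : `|m (arens_lmod n f)| <= `|m| * `|n| * `|f|.
Proof.
by rewrite (le_trans (dual_le m _))// -mulrA ler_wpM2l// arens_lmod_norm.
Qed.

(* First Arens product: <m.n, f> = <m, n.f> *)
Definition arens1 m n : A'' :=
  dual_of (arens1_linear m n) (ex_intro _ (`|m| * `|n|) (arens1_le m n)).

Lemma arens_rmod_linear f m : linear (fun a => m (dual_lact (X := reg) a f)).
Proof.
move=> c a b; have /= -> := lact_linearl (b0 := dual_bimodule reg) f c a b.
by rewrite dual_linear.
Qed.

Lemma arens_rmod_le f m a :
  `|m (dual_lact (X := reg) a f)| <= `|m| * `|f| * `|a|.
Proof.
by rewrite (le_trans (dual_le m _))// -mulrA ler_wpM2l// regular_lact_le.
Qed.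

(* <f [] m, a> = <m, a.f> *)
Definition arens_rmod f m : A' :=
  dual_of (arens_rmod_linear f m) (ex_intro _ (`|m| * `|f|) (arens_rmod_le f m)).

Lemma arens_rmod_norm f m : `|arens_rmod f m| <= `|m| * `|f|.
Proof. by apply: dual_leP => [|a]; [rewrite mulr_ge0|exact: arens_rmod_le]. Qed.

Lemma arens2_linear m n : linear (fun f => n (arens_rmod f m)).
Proof.
move=> c f g; rewrite -dual_linear; congr (n _); apply: dualE => a /=.
have /= -> := lact_linearr (b0 := dual_bimodule reg) a c f g.
by rewrite dual_linear.
Qed.

Lemma arens2_le m n f : `|n (arens_rmod f m)| <= `|n| * `|m| * `|f|.
Proof.
by rewrite (le_trans (dual_le n _))// -mulrA ler_wpM2l// arens_rmod_norm.
Qed.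

(* Second Arens product: <m [] n, f> = <n, f [] m> *)
Definition arens2 m n : A'' :=
  dual_of (arens2_linear m n) (ex_intro _ (`|n| * `|m|) (arens2_le m n)).

Definition arens_regular := forall m n, arens1 m n = arens2 m n.

Definition bidual_algebra : banachAlgebra R.
Proof.
refine (@BanachAlgebra R A'' arens1 _ _ _ _).
- by move=> n c m p; apply: dualE.
- move=> m c n p; apply: dualE => f /=.
  by rewrite -[RHS]dual_linear; congr (m _); apply: dualE.
- move=> m n p; apply: dualE => f /=; congr (m _); apply: dualE => a /=.
  congr (n _); apply: dualE => x /=; congr (p _); apply: dualE => y /=.
  by rewrite ba_mulA.
- by move=> m n; apply: dual_leP; [rewrite mulr_ge0|exact: arens1_le].
Defined.

Lemma bidual_restr_linear (F : dual A'') :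
  linear (fun a => F (canon a)).
Proof. by move=> c a b; rewrite linearP dual_linear. Qed.

Lemma bidual_restr_le (F : dual A'') a : `|F (canon a)| <= `|F| * `|a|.
Proof. by rewrite (le_trans (dual_le _ _))// ler_wpM2l// canon_norm. Qed.

Lemma bidual_predual : arens_regular ->
  @is_predual R bidual_algebra (range (@canon R A')).
Proof.
move=> reg; split.
- move=> F clF; pose f := dual_of (bidual_restr_linear F)
    (ex_intro _ `|F| (bidual_restr_le F)).
  exists f => //; apply/eqP; rewrite -subr_eq0 -normr_le0.
  apply/ler_addgt0Pl => e e0; rewrite addr0.
  have e20 : 0 < e / 2 by rewrite divr_gt0.
  have [_ [[g _ <-] /=]] := clF _ (nbhsx_ballx F _ e20).
  rewrite -ball_normE/= => Fg.
  rewrite -(subrK (canon g) (canon f)) -addrA.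
  apply: (le_trans (ler_normD _ _)); rewrite [leRHS]splitr.
  apply: lerD; last by rewrite distrC; exact: ltW.
  rewrite -linearB/= (le_trans (canon_norm _))//.
  apply: dual_leP; first exact: ltW.
  move=> a; rewrite -[(f - g) a]/((F - canon g) (canon a)).
  rewrite (le_trans (dual_le (F - canon g) (canon a)))// ler_pM// ?canon_norm//.
  exact: ltW.
- by exists 0 => //; rewrite linear0.
- by move=> c _ _ [f _ <-] [g _ <-]; exists (c *: f + g) => //; rewrite linearP.
- by move=> m _ [f _ <-]; exists (arens_lmod m f) => //; apply: dualE.
- move=> _ m [f _ <-]; exists (arens_rmod f m) => //; apply: dualE => n /=.
  by rewrite -[RHS]/(arens1 m n f) reg.
- move=> phi phil [k phik].
  have bl : linear (fun f : A' => phi (canon f) : R[i]^o).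
    by move=> c f g; rewrite linearP phil.
  have bb : bounded_map (fun f : A' => phi (canon f) : R[i]^o).
    exists `|k| => f; have := phik (canon f) (imageT _ f).
    have [->|f0 H] := eqVneq `|canon f| 0.
      by rewrite mulr0 => H; rewrite (le_trans H)// mulr_ge0.
    have cf : 0 < `|canon f| by rewrite lt_def f0/=.
    have k0 : 0 <= k by rewrite -(pmulr_lge0 k cf) (le_trans _ H).
    by rewrite (ger0_norm k0) (le_trans H)// ler_wpM2l// canon_norm.
  by exists (dual_of bl bb) => _ [f _ <-].
- exists 1 => m M M0 mM; rewrite mul1r; apply: dual_leP => // f.
  by rewrite (le_trans (mM (canon f) (imageT _ f)))// ler_wpM2l// canon_norm.
Qed.

Definition bidual_dualBanachAlgebra (reg : arens_regular) : dualBanachAlgebra R :=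
  DualBanachAlgebra (bidual_predual reg).

Definition ideal_in_bidual :=
  forall m a, range (@canon R A) (arens1 m (canon a)) /\
              range (@canon R A) (arens1 (canon a) m).

End Arens.

Definition has_identity (R : realType) (B : banachAlgebra R) :=
  exists e : B, forall b : B, ba_mul e b = b /\ ba_mul b e = b.

(* Main.v *)
From HB Require Import structures.
From mathcomp Require Import all_boot all_order all_algebra.
From mathcomp Require Import all_classical all_reals all_analysis.
From mathcomp Require Import complex.
Require Import Defs.

Set Implicit Arguments.
Unset Strict Implicit.
Unset Printing Implicit Defensive.

Import Order.TTheory GRing.Theory Num.Theory numFieldNormedType.Exports.

Local Open Scope classical_set_scope.
Local Open Scope ring_scope.
Local Open Scope complex_scope.

(** Write A' and A'' for the dual and the bidual of A, and keep the first Arens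
    product on A''; by regularity it is also the second one.

    The dual case.  If A has the predual P, then restricting a functional on A'
    to P and reading the restriction as an element of A gives a map from A'' to
    A.  As P is a submodule of A', this map is an algebra homomorphism; it is
    weak-star continuous because composing it with an element f of P is
    evaluation at f, and it fixes A ([predual_projE], [predual_projM],
    [predual_proj_canon]).  Normal bimodules and weak-star continuous
    derivations over A pull back along it to A'', and a net that implements the
    pulled back derivation implements the original one.

    The ideal case.  Let e be the identity of A'', X a bimodule over A and D a
    derivation from A to the dual of X.  Since A is an ideal of A'', the algebra
    A'' acts on formal sandwiches by m.(a x b) = (m a) x b and
    (a x b).m = a x (b m).  The point is to make this well defined.  Any bounded
    bilinear form on X and A extends in its second variable to A'', so A'' acts
    on both sides of the dual of X, hence, by transposition, on both sides of
    the bidual of X.  These two actions need not commute, but on the canonical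
    image of a x b they are given by the formulas above; hence they commute on
    the closed span Z of all sandwiches, and Z is a bimodule over A''.  Its dual
    is normal: on a sandwich the orbit maps are evaluations at elements of A',
    and A' is closed in the dual of A'' ([essential_normal]).

    The extension of D to A'', restricted to Z, is a weak-star continuous
    derivation ([essential_ext_derivation]), for on sandwiches it is
      m |-> (a x b |-> D (m a) (x b) - D a (x (b m))).
    So it is implemented by a net in the dual of Z.  Functionals on Z return to
    functionals on X through
      zeta |-> (x |-> e (c |-> e (b |-> zeta (b x c)))),
    a bounded map of A-bimodules ([descent_lact], [descent_ract]).  It sends the
    extended derivation to e.(D a).e, and D differs from a |-> e.(D a).e by an
    inner derivation ([derivation_decomposition]); the descended net, shifted by
    a constant, implements D.  Working in the bidual of X replaces bounded
    approximate identities and the factorization of the elements of X. *)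

(** * Bounded linear maps and weak-star continuity *)

(** The bounds assumed of maps and actions carry an arbitrary complex constant;
    as soon as [k * t] dominates a nonnegative number it is its own modulus, so
    the constant may be replaced by its modulus. *)
Lemma ler_normMl (R : realType) (k s t : R[i]) :
  0 <= s -> 0 <= t -> s <= k * t -> s <= `|k| * t.
Proof.
move=> s0 t0 skt.
rewrite -[leRHS]ger0_norm ?mulr_ge0// normrM normr_id -normrM.
by rewrite ger0_norm// (le_trans s0).
Qed.

Lemma bounded_map_ge0 (R : realType) (V W : normedModType R[i]) (f : V -> W) :
  bounded_map f -> exists2 k : R[i], 0 <= k & forall x, `|f x| <= k * `|x|.
Proof. by move=> [k fk]; exists `|k| => // x; exact: ler_normMl. Qed.

Section linear_maps.
Context (R : realType).

Lemma bilinear_bound_ge0 (V U W : normedModType R[i]) (f : V -> U -> W) :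
  (exists k : R[i], forall v u, `|f v u| <= k * `|v| * `|u|) ->
  exists2 k : R[i], 0 <= k & forall v u, `|f v u| <= k * `|v| * `|u|.
Proof.
move=> [k fk]; exists `|k| => // v u; rewrite -mulrA.
by apply: ler_normMl; rewrite ?mulr_ge0// mulrA.
Qed.

Lemma linear_map0 (V W : normedModType R[i]) (f : V -> W) : linear f -> f 0 = 0.
Proof. by move=> fl; rewrite -[in LHS](subrr 0) (zmod_morphism_linear fl) subrr. Qed.

Lemma bounded_linear_continuous (V W : normedModType R[i]) (f : V -> W) :
  linear f -> bounded_map f -> continuous f.
Proof.
move=> fl /bounded_map_ge0[k k0 fk] x; apply/cvgrPdist_lt => e e0.
have k1 : 0 < k + 1 by rewrite ltr_wpDl.
near=> y.
rewrite -(zmod_morphism_linear fl).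
apply: (@le_lt_trans _ _ ((k + 1) * `|x - y|)).
  by rewrite (le_trans (fk _))// ler_wpM2r// lerDl.
rewrite -ltr_pdivlMl//; near: y.
by apply: cvgr_dist_lt => //; rewrite mulr_gt0// invr_gt0.
Unshelve. all: by end_near. Qed.

Lemma closed_linear_preimage (V W : normedModType R[i]) (f : V -> W) (S : set W) :
  linear f -> bounded_map f -> closed S -> closed (f @^-1` S).
Proof.
move=> fl fb cS; apply: preimage_closed => // x _.
exact: bounded_linear_continuous.
Qed.

End linear_maps.

Section weak_star_maps.
Context (R : realType).

Lemma weak_star_eval_continuous (V : normedModType R[i]) (P : set (dual V)) f :
  P f -> continuous (fun x : weak_star P => f x : R[i]^o).
Proof.
move=> Pf x; pose emb : V -> {ptws P -> R[i]^o} := fun x (g : P) => \val g x.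
pose ev : {ptws P -> R[i]^o} -> R[i]^o := fun h => h (exist _ f (mem_set Pf)).
apply: (@continuous_comp (weak_star P) _ _ emb ev).
  exact: initial_continuous.
exact: proj_continuous.
Qed.

(** The target carries the initial topology of its functionals in [Q], so
    continuity is tested on each of them. *)
Lemma weak_star_continuousP (V W : normedModType R[i])
    (P : set (dual V)) (Q : set (dual W)) (T : V -> W) :
  (forall g, Q g -> continuous (fun x : weak_star P => g (T x) : R[i]^o)) ->
  weak_star_continuous P Q T.
Proof.
move=> QT; apply: continuous_comp_initial => x.
pose emb : weak_star P -> {ptws Q -> R[i]^o} := fun x (g : Q) => \val g (T x).
have FF : Filter (emb @ nbhs x) by exact: fmap_filter.
apply: (pointwise_cvgP (emb x) FF).2 => -[g Qg].
exact: QT (set_mem Qg) x.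
Qed.

End weak_star_maps.

(** * Bilinear forms and extension to the bidual *)

Section bilinear_forms.
Context (R : realType).

Record bform (V U : normedModType R[i]) := Bform {
  bf_fun :> V -> U -> R[i]^o ;
  bf_linearl : forall u, linear (bf_fun^~ u) ;
  bf_linearr : forall v, linear (bf_fun v) ;
  bf_bounded : exists k : R[i], forall v u,
    `|bf_fun v u| <= k * `|v| * `|u| }.

Section contraction.
Context (V U : normedModType R[i]) (B : bform V U).

Lemma bf_app_bounded v : bounded_map (B v).
Proof. by have [k Bk] := bf_bounded B; exists (k * `|v|). Qed.

Definition bf_app v : dual U := dual_of (bf_linearr B v) (bf_app_bounded v).

Lemma bf_app_linear : linear bf_app.
Proof. by move=> c v w; apply: dualE => u; exact: bf_linearl. Qed.

Lemma bf_app_bound : bounded_map bf_app.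
Proof.
have [k k0 Bk] := bilinear_bound_ge0 (bf_bounded B).
exists k => v; apply: dual_leP => [|u]; first by rewrite mulr_ge0.
exact: Bk.
Qed.

Lemma contract_linear (F : dual (dual U)) : linear (fun v => F (bf_app v) : R[i]^o).
Proof. by move=> c v w; rewrite bf_app_linear dual_linear. Qed.

Lemma contract_bounded (F : dual (dual U)) :
  bounded_map (fun v => F (bf_app v) : R[i]^o).
Proof.
have [k k0 Bk] := bounded_map_ge0 bf_app_bound.
exists (`|F| * k) => v; rewrite (le_trans (dual_le _ _))// -mulrA.
by rewrite ler_wpM2l.
Qed.

(** A functional [F] on the dual of [U] absorbs the second variable of [B]; for
    [F = canon u] this is evaluation at [u]. *)
Definition contract (F : dual (dual U)) : dual V :=
  dual_of (contract_linear F) (contract_bounded F).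

(** Representing [B v] by any functional with the same values hides the proofs
    of linearity and boundedness packed in [bf_app]. *)
Lemma contractE F v (f : dual U) : (forall u, f u = B v u) -> contract F v = F f.
Proof. by move=> fB; congr (F _); apply: dualE => u; rewrite fB. Qed.

Lemma contract_linearr : linear contract.
Proof. by move=> c F G; apply: dualE. Qed.

Lemma contract_le (k : R[i]) F : 0 <= k ->
  (forall v u, `|B v u| <= k * `|v| * `|u|) -> `|contract F| <= k * `|F|.
Proof.
move=> k0 Bk; apply: dual_leP => [|v]; first by rewrite mulr_ge0.
rewrite (le_trans (dual_le F _))// [k * _]mulrC -mulrA ler_wpM2l//.
by apply: dual_leP => [|u]; [rewrite mulr_ge0|exact: Bk].
Qed.

End contraction.

Section operator_form.
Context (V U : normedModType R[i]) (T : V -> dual U).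
Hypotheses (Tl : linear T) (Tb : bounded_map T).

Definition op_form : bform U V.
Proof.
refine (@Bform U V (fun u v => T v u) _ _ _).
- by move=> v c u w; rewrite dual_linear.
- by move=> u c v w; rewrite Tl.
- have [k k0 Tk] := bounded_map_ge0 Tb; exists k => u v.
  by rewrite (le_trans (dual_le _ _))// mulrAC ler_wpM2r.
Defined.

(** The weak-star continuous extension of [T] to the bidual of [V]. *)
Definition bidual_ext (m : dual (dual V)) : dual U := contract op_form m.

Lemma bidual_extE m u (f : dual V) : (forall v, f v = T v u) ->
  bidual_ext m u = m f.
Proof. exact: (@contractE _ _ op_form m u f). Qed.

Lemma bidual_ext_linear : linear bidual_ext.
Proof. exact: contract_linearr. Qed.

Lemma bidual_ext_le (k : R[i]) m : 0 <= k -> (forall v, `|T v| <= k * `|v|) ->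
  `|bidual_ext m| <= k * `|m|.
Proof.
move=> k0 Tk; apply: contract_le => // u v /=.
by rewrite (le_trans (dual_le _ _))// mulrAC ler_wpM2r.
Qed.

End operator_form.

End bilinear_forms.

(** * Closed linear spans as Banach spaces *)

Section closed_span.
Context (R : realType) (V : completeNormedModType R[i]) (E : set V).

(** The closed span is taken as the intersection of all closed subspaces that
    contain [E]: this form is its own induction principle. *)
Definition in_closed_span : {pred V} := fun v =>
  `[< forall S : set V, closed S -> S 0 ->
        (forall (c : R[i]) x y, S x -> S y -> S (c *: x + y)) ->
        E `<=` S -> S v >].

Lemma in_closed_span_submod_closed : submod_closed in_closed_span.
Proof.
split=> [|c x y /asboolP xE /asboolP yE]; apply/asboolP => S cS S0 SD ES //.
have [Sx Sy] := (xE S cS S0 SD ES, yE S cS S0 SD ES); exact: SD.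
Qed.

HB.instance Definition _ := GRing.isSubmodClosed.Build R[i] V
  in_closed_span in_closed_span_submod_closed.

Record closed_span := ClosedSpan {
  span_val :> V ;
  span_valP : span_val \in in_closed_span }.

HB.instance Definition _ := [isSub for span_val].
HB.instance Definition _ := [Choice of closed_span by <:].
HB.instance Definition _ := [SubChoice_isSubLmodule of closed_span by <:].

Definition span_norm (z : closed_span) : R[i] := `|span_val z|.

Lemma span_normD x y : span_norm (x + y) <= span_norm x + span_norm y.
Proof. exact: ler_normD. Qed.

Lemma span_normZ a x : span_norm (a *: x) = `|a| * span_norm x.
Proof. exact: normrZ. Qed.

Lemma span_norm0_eq0 x : span_norm x = 0 -> x = 0.
Proof. by move/normr0_eq0 => x0; apply: val_inj. Qed.

HB.instance Definition _ := Lmodule_isNormed.Build R[i] closed_span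
  span_normD span_normZ span_norm0_eq0.

Lemma span_norm_val (z : closed_span) : `|z| = `|span_val z|.
Proof. by []. Qed.

Lemma in_closed_span_gen v : E v -> v \in in_closed_span.
Proof. by move=> Ev; apply/asboolP => S _ _ _; exact. Qed.

Lemma closed_in_closed_span : closed [set v | v \in in_closed_span].
Proof.
move=> v clv; apply/asboolP => S cS S0 SD ES.
apply: (cS) => U /clv[w [/asboolP wE Uw]].
by exists w; split => //; exact: (wE S cS S0 SD ES).
Qed.

(** The images in [V] of the elements satisfying [S] form a closed subspace of
    [V]: a limit of such images lies in the closed span, and the embedding is
    isometric. *)
Lemma closed_span_ind (S : set closed_span) : closed S -> S 0 ->
  (forall (c : R[i]) x y, S x -> S y -> S (c *: x + y)) ->
  (forall z, E (span_val z) -> S z) -> forall z, S z.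
Proof.
move=> cS S0 SD ES z; have /asboolP := span_valP z.
move=> /(_ [set v | exists2 y, S y & span_val y = v])[]//.
- move=> v clv.
  have vE : v \in in_closed_span.
    apply: closed_in_closed_span => U /clv[_ [[y _ <-] Uy]].
    by exists (span_val y); split => //; exact: span_valP.
  exists (ClosedSpan vE) => //; apply: cS => U /nbhs_ballP[e /= e0 eU].
  have [_ [[y Sy <-]]] := clv _ (nbhsx_ballx v _ e0).
  rewrite -ball_normE/= => ye; exists y; split => //; apply: eU.
  by rewrite -ball_normE.
- by exists 0.
- by move=> c _ _ [x Sx <-] [y Sy <-]; exists (c *: x + y) => //; exact: SD.
- by move=> v Ev; exists (ClosedSpan (in_closed_span_gen Ev)) => //; exact: ES.
by move=> y Sy /val_inj <-.
Qed.

(** A Cauchy filter converges in [V], and its limit stays in the closed span. *)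
Lemma closed_span_cauchy_cvg (F : set_system closed_span) : ProperFilter F ->
  cauchy F -> cvg F.
Proof.
move=> FF Fc.
have : cvg (span_val @ F).
  apply: cauchy_cvg; apply/cauchyP => e e0.
  move/cauchyP : Fc => /(_ e e0)[z zF]; exists (span_val z).
  change (F (span_val @^-1` ball (span_val z) e)).
  by apply: filterS zF => w; rewrite /preimage/= -!ball_normE.
move/cvg_ex => [v vF].
have vE : v \in in_closed_span.
  apply: closed_in_closed_span => U /vF UF.
  have /filter_ex[z Uz] : F (span_val @^-1` U) by [].
  by exists (span_val z); split => //; exact: span_valP.
apply/cvg_ex; exists (ClosedSpan vE); apply/cvgrPdist_lt => e e0.
by move/cvgrPdist_lt : vF => /(_ _ e0).
Qed.

HB.instance Definition _ :=
  Uniform_isComplete.Build closed_span closed_span_cauchy_cvg.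

End closed_span.

Section closed_span_maps.
Context (R : realType) (V : completeNormedModType R[i]) (E : set V).

Lemma closed_span_stable (T : V -> V) : linear T -> bounded_map T ->
  (forall v, E v -> T v \in in_closed_span E) ->
  forall v, v \in in_closed_span E -> T v \in in_closed_span E.
Proof.
move=> Tl Tb TE v /asboolP /(_ (T @^-1` [set w | w \in in_closed_span E])).
apply => [|||w Ew]; last exact: TE.
- by apply: closed_linear_preimage => //; exact: closed_in_closed_span.
- rewrite /preimage/= (linear_map0 Tl).
  exact: (in_closed_span_submod_closed E).1.
- move=> c x y xE yE; rewrite /preimage/= Tl.
  exact: (in_closed_span_submod_closed E).2.
Qed.

Lemma closed_span_eq (W : normedModType R[i]) (T1 T2 : V -> W) :
  linear T1 -> bounded_map T1 -> linear T2 -> bounded_map T2 ->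
  (forall v, E v -> T1 v = T2 v) ->
  forall v, v \in in_closed_span E -> T1 v = T2 v.
Proof.
move=> T1l /bounded_map_ge0[k k0 T1k] T2l /bounded_map_ge0[l l0 T2l'] TE v /asboolP.
pose T v := T1 v - T2 v.
have Tl : linear T.
  move=> c x y; rewrite /T T1l T2l scalerBr opprD.
  by rewrite addrACA.
have Tb : bounded_map T.
  exists (k + l) => x; rewrite (le_trans (ler_normB _ _))// mulrDl.
  by rewrite lerD.
have T00 := linear_map0 Tl.
move=> /(_ (T @^-1` [set 0])) H; apply/eqP; rewrite -subr_eq0; apply/eqP.
apply: H => //.
- apply: closed_linear_preimage => //.
  by apply/accessible_closed_set1/hausdorff_accessible/norm_hausdorff.
- by move=> c x y; rewrite /preimage/= Tl => -> ->; rewrite scaler0 addr0.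
- by move=> w /TE TE'; rewrite /preimage/= /T TE' subrr.
Qed.

End closed_span_maps.

(** * Dual Banach algebras inherit approximate Connes-amenability *)

Section pullback.
Context (R : realType) (B A : banachAlgebra R) (theta : B -> A).
Hypothesis theta_linear : linear theta.
Hypothesis theta_bounded : bounded_map theta.
Hypothesis thetaM : forall m n, theta (ba_mul m n) = ba_mul (theta m) (theta n).

(** Restriction of scalars along [theta]. *)
Definition pullback (X : banachBimodule A) : banachBimodule B.
Proof.
refine (@BanachBimodule R B X (fun m x => lact (theta m) x)
  (fun x m => ract x (theta m)) _ _ _ _ _ _ _ _ _).
- by move=> x c m n; rewrite theta_linear lact_linearl.
- by move=> m; exact: lact_linearr.
- by move=> m; exact: ract_linearl.
- by move=> x c m n; rewrite theta_linear ract_linearr.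
- by move=> m n x; rewrite lactA thetaM.
- by move=> x m n; rewrite ractA thetaM.
- by move=> m x n; rewrite lractA.
- have [k kX] := lact_bounded X; have [l l0 lb] := bounded_map_ge0 theta_bounded.
  exists (`|k| * l) => m x.
  apply: (@le_trans _ _ (`|k| * (`|theta m| * `|x|))).
    by apply: ler_normMl; rewrite ?mulr_ge0// mulrA.
  by rewrite -!mulrA ler_wpM2l// mulrA ler_wpM2r.
- have [k kX] := ract_bounded X; have [l l0 lb] := bounded_map_ge0 theta_bounded.
  exists (`|k| * l) => x m.
  apply: (@le_trans _ _ (`|k| * (`|x| * `|theta m|))).
    by apply: ler_normMl; rewrite ?mulr_ge0// mulrA.
  by rewrite -!mulrA ler_wpM2l// mulrCA ler_wpM2l.
Defined.

Lemma derivation_pullback (X : banachBimodule A) (D : A -> dual_bimodule X) :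
  derivation D ->
  @derivation R B (dual_bimodule (pullback X)) (fun m => D (theta m)).
Proof.
move=> [Dl Db DM]; split.
- by move=> c m n; rewrite theta_linear Dl.
- have [k k0 kD] := bounded_map_ge0 Db.
  have [l l0 lb] := bounded_map_ge0 theta_bounded.
  by exists (k * l) => m; rewrite (le_trans (kD _))// -mulrA ler_wpM2l.
- by move=> m n; rewrite thetaM DM; congr (_ + _); apply: dualE.
Qed.

End pullback.

Section predual_projection.
Context (R : realType) (A : banachAlgebra R) (P : set (dual A)).
Hypothesis predP : is_predual P.

Lemma predual_separates (a b : A) : (forall f, P f -> f a = f b) -> a = b.
Proof.
move=> ab; have [k kP] := predual_below predP.
apply/eqP; rewrite -subr_eq0 -normr_le0 -(mulr0 k); apply: kP => // f /ab fab.
by rewrite linearB/= fab subrr normr0 mul0r.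
Qed.

(** Restricted to [P], a functional on the dual of [A] is a bounded functional
    on the predual, that is, an element of [A]. *)
Lemma predual_proj_subproof (m : dual (dual A)) :
  exists b : A, forall f, P f -> m f = f b.
Proof.
apply: (predual_onto predP) => [c f g _ _|]; first exact: dual_linear.
by exists `|m| => f _; exact: dual_le.
Qed.

Definition predual_proj (m : bidual_algebra A) : A :=
  sval (cid (predual_proj_subproof m)).

Lemma predual_projE m f : P f -> f (predual_proj m) = m f.
Proof. by move=> Pf; rewrite /predual_proj; case: cid => b /= ->. Qed.

Lemma predual_proj_linear : linear predual_proj.
Proof.
move=> c m n; apply: predual_separates => f Pf.
by rewrite dual_linear !predual_projE.
Qed.

Lemma predual_proj_bounded : bounded_map predual_proj.
Proof.
have [k kP] := predual_below predP; exists k => m; apply: kP => // f Pf.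
by rewrite predual_projE// dual_le.
Qed.

Lemma predual_proj_canon a : predual_proj (canon a) = a.
Proof. by apply: predual_separates => f Pf; rewrite predual_projE. Qed.

(** For [f] in [P] the functional [n.f] only sees the values of [n] on [P],
    because [f.a] is in [P]; so it is the translate of [f] by the projection of
    [n], which is again in [P]. *)
Lemma predual_projM m n :
  predual_proj (ba_mul m n) = ba_mul (predual_proj m) (predual_proj n).
Proof.
apply: predual_separates => f Pf; rewrite predual_projE//=.
have -> : arens_lmod n f =
    @lact _ _ (dual_bimodule (regular_bimodule A)) (predual_proj n) f.
  apply: dualE => a /=.
  have := predual_projE n (predual_ract predP a Pf).
  by move=> /= <-.
by rewrite -(predual_projE m (predual_lact predP _ Pf)).
Qed.

Lemma predual_proj_continuous (X : normedModType R[i]) (Q : set (dual X))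
    (T : A -> X) : weak_star_continuous P Q T ->
  weak_star_continuous (range (@canon R (dual A))) Q
    (fun m : bidual_algebra A => T (predual_proj m)).
Proof.
move=> cT; pose pi : weak_star (range (@canon R (dual A))) -> weak_star P :=
  predual_proj.
have cpi : continuous pi.
  apply: weak_star_continuousP => f Pf.
  have -> : (fun m => f (predual_proj m) : R[i]^o) =
            (fun m => canon f m : R[i]^o).
    by apply/funext => m; rewrite predual_projE.
  apply: weak_star_eval_continuous; exact: imageT.
move=> m; exact: (continuous_comp (cpi m) (cT (pi m))).
Qed.

End predual_projection.

(** The projection of the bidual onto [A] fixes [A], so a net that implements
    [D] composed with the projection implements [D] at the image of each [a]. *)
Lemma Connes_amenable_of_bidual (R : realType) (A : banachAlgebra R)
    (regA : arens_regular A) (P : set (dual A)) (predP : is_predual P) :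
  approximately_Connes_amenable (bidual_dualBanachAlgebra regA) ->
  approximately_Connes_amenable (DualBanachAlgebra predP).
Proof.
move=> amenA X Xn D Dd Dc.
have pil := predual_proj_linear predP.
have pib := predual_proj_bounded predP.
have piM := predual_projM predP.
have Yn : @normal_dual _ (bidual_dualBanachAlgebra regA) (pullback pil pib piM X).
  move=> phi; have [cl cr] := Xn phi; split.
    (* The two sides have the same values but carry different proofs of
     boundedness, so they are identified by extensionality. *)
    rewrite (_ : (fun m => _) =
        (fun m => @lact _ _ (dual_bimodule X) (predual_proj predP m) phi)).
    exact: (predual_proj_continuous cl).
    by apply/funext => m; exact: dualE.
  rewrite (_ : (fun m => _) =
      (fun m => @ract _ _ (dual_bimodule X) phi (predual_proj predP m))).
    exact: (predual_proj_continuous cr).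
  by apply/funext => m; exact: dualE.
have [I [le [x [dirI xD]]]] := amenA _ Yn _ (derivation_pullback pil pib piM Dd)
  (predual_proj_continuous (predP := predP) Dc).
exists I, le, x; split=> // a; have := xD (canon a).
rewrite predual_proj_canon.
rewrite (_ : (fun i => _) = (fun i => @lact _ _ (dual_bimodule X) a (x i) -
    @ract _ _ (dual_bimodule X) (x i) a)) //.
apply/funext => i; congr (_ - _); apply: dualE => y /=;
  by rewrite predual_proj_canon.
Qed.

(** * Actions of the bidual algebra on dual spaces *)

Section arens_canon.
Context (R : realType) (A : banachAlgebra R).

Lemma arens_canonl (m : dual (dual A)) (a : A) (f : dual A) :
  arens1 m (canon a) f = m (@lact _ _ (dual_bimodule (regular_bimodule A)) a f).
Proof. by congr (m _); apply: dualE. Qed.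

Lemma arens_canonr (m : dual (dual A)) (a : A) (f : dual A) :
  arens1 (canon a) m f = m (@ract _ _ (dual_bimodule (regular_bimodule A)) f a).
Proof. by []. Qed.

Lemma arens_canonM (a b : A) : arens1 (canon a) (canon b) = canon (ba_mul a b).
Proof. exact: dualE. Qed.

End arens_canon.

Section bidual_actions.
Context (R : realType) (A : banachAlgebra R) (X : banachBimodule A).
Implicit Types (phi : dual X) (m n : dual (dual A)) (Phi : dual (dual X)).

Lemma dual_ract_map_linear phi : linear (dual_ract phi).
Proof. exact: (ract_linearr (b0 := dual_bimodule X)). Qed.

Lemma dual_ract_map_bounded phi : bounded_map (dual_ract phi).
Proof.
have [k ka] := ract_bounded (dual_bimodule X); exists (k * `|phi|) => a.
exact: ka.
Qed.

Lemma dual_lact_map_linear phi : linear (fun a => dual_lact a phi).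
Proof. exact: (lact_linearl (b0 := dual_bimodule X)). Qed.

Lemma dual_lact_map_bounded phi : bounded_map (fun a => dual_lact a phi).
Proof.
have [k ka] := lact_bounded (dual_bimodule X); exists (k * `|phi|) => a.
by rewrite mulrAC; exact: ka.
Qed.

(** [<phi.m, x> = <m, c |-> phi (c.x)>]. *)
Definition bidual_ract phi m : dual X :=
  bidual_ext (dual_ract_map_linear phi) (dual_ract_map_bounded phi) m.

(** [<m.phi, x> = <m, c |-> phi (x.c)>]. *)
Definition bidual_lact m phi : dual X :=
  bidual_ext (dual_lact_map_linear phi) (dual_lact_map_bounded phi) m.

Lemma bidual_ractE phi m x (f : dual A) :
  (forall c, f c = phi (lact c x)) -> bidual_ract phi m x = m f.
Proof. by move=> fE; apply: bidual_extE. Qed.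

Lemma bidual_lactE phi m x (f : dual A) :
  (forall c, f c = phi (ract x c)) -> bidual_lact m phi x = m f.
Proof. by move=> fE; apply: bidual_extE. Qed.

Definition orbitl phi x : dual A :=
  bf_app (op_form (dual_ract_map_linear phi) (dual_ract_map_bounded phi)) x.

Definition orbitr phi x : dual A :=
  bf_app (op_form (dual_lact_map_linear phi) (dual_lact_map_bounded phi)) x.

Lemma bidual_ract_bounded : exists k : R[i], forall phi m,
  `|bidual_ract phi m| <= k * `|phi| * `|m|.
Proof.
have [k k0 ka] := bilinear_bound_ge0 (ract_bounded (dual_bimodule X)).
exists k => phi m; apply: bidual_ext_le; first by rewrite mulr_ge0.
by move=> a; exact: ka.
Qed.

Lemma bidual_lact_bounded : exists k : R[i], forall m phi,
  `|bidual_lact m phi| <= k * `|m| * `|phi|.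
Proof.
have [k k0 ka] := bilinear_bound_ge0 (lact_bounded (dual_bimodule X)).
exists k => m phi; rewrite mulrAC; apply: bidual_ext_le; first by rewrite mulr_ge0.
by move=> a; rewrite mulrAC; exact: ka.
Qed.

Lemma bidual_ract_linearl m : linear (bidual_ract^~ m).
Proof.
move=> c phi psi; apply: dualE => x.
by rewrite (@bidual_ractE _ m x (c *: orbitl phi x + orbitl psi x))// dual_linear.
Qed.

Lemma bidual_ract_linearr phi : linear (bidual_ract phi).
Proof. exact: bidual_ext_linear. Qed.

Lemma bidual_lact_linearr m : linear (bidual_lact m).
Proof.
move=> c phi psi; apply: dualE => x.
by rewrite (@bidual_lactE _ m x (c *: orbitr phi x + orbitr psi x))// dual_linear.
Qed.

Lemma bidual_lact_linearl phi : linear (bidual_lact^~ phi).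
Proof. exact: bidual_ext_linear. Qed.

(** The right action is associative for the second Arens product, the left one
    for the first; regularity is what makes them actions of one algebra. *)
Lemma bidual_ractA phi m n :
  bidual_ract (bidual_ract phi m) n = bidual_ract phi (arens2 m n).
Proof.
apply: dualE => x; rewrite (@bidual_ractE phi _ x (orbitl phi x))//=.
apply: bidual_ractE => c /=; apply/esym/bidual_ractE => b /=.
by rewrite lactA.
Qed.

Lemma bidual_lactA m n phi :
  bidual_lact m (bidual_lact n phi) = bidual_lact (arens1 m n) phi.
Proof.
apply: dualE => x; rewrite (@bidual_lactE phi _ x (orbitr phi x))//=.
apply: bidual_lactE => c /=; apply/esym/bidual_lactE => b /=.
by rewrite ractA.
Qed.

Lemma bidual_ract_canon phi a : bidual_ract phi (canon a) = dual_ract phi a.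
Proof. exact: dualE. Qed.

Lemma bidual_lact_canon phi a : bidual_lact (canon a) phi = dual_lact a phi.
Proof. exact: dualE. Qed.

Lemma second_lact_linear m Phi : linear (fun phi => Phi (bidual_ract phi m) : R[i]^o).
Proof. by move=> c phi psi; rewrite bidual_ract_linearl dual_linear. Qed.

Lemma second_ract_linear m Phi : linear (fun phi => Phi (bidual_lact m phi) : R[i]^o).
Proof. by move=> c phi psi; rewrite bidual_lact_linearr dual_linear. Qed.

Lemma second_lact_le : exists2 k : R[i], 0 <= k & forall m Phi phi,
  `|Phi (bidual_ract phi m)| <= k * `|m| * `|Phi| * `|phi|.
Proof.
have [k k0 kb] := bilinear_bound_ge0 bidual_ract_bounded.
exists k => // m Phi phi; rewrite (le_trans (dual_le Phi _))//.
rewrite [k * _ * _]mulrAC [_ * `|Phi|]mulrC -!mulrA ler_wpM2l//.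
have := kb phi m; rewrite -mulrA [_ * `|m|]mulrC; exact.
Qed.

Lemma second_ract_le : exists2 k : R[i], 0 <= k & forall m Phi phi,
  `|Phi (bidual_lact m phi)| <= k * `|Phi| * `|m| * `|phi|.
Proof.
have [k k0 kb] := bilinear_bound_ge0 bidual_lact_bounded.
exists k => // m Phi phi; rewrite (le_trans (dual_le Phi _))//.
rewrite [k * _]mulrC -!mulrA ler_wpM2l// !mulrA; exact: kb.
Qed.

Lemma second_lact_bounded m Phi :
  bounded_map (fun phi => Phi (bidual_ract phi m) : R[i]^o).
Proof. by have [k _ kb] := second_lact_le; exists (k * `|m| * `|Phi|). Qed.

Lemma second_ract_bounded m Phi :
  bounded_map (fun phi => Phi (bidual_lact m phi) : R[i]^o).
Proof. by have [k _ kb] := second_ract_le; exists (k * `|Phi| * `|m|). Qed.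

(** The transposes, on the bidual of [X], of the actions on its dual.  Each is
    associative, but they need not commute with one another: that would
    interchange two iterated limits. *)
Definition second_lact m Phi : dual (dual X) :=
  dual_of (second_lact_linear m Phi) (second_lact_bounded m Phi).

Definition second_ract Phi m : dual (dual X) :=
  dual_of (second_ract_linear m Phi) (second_ract_bounded m Phi).

Lemma second_lact_norm : exists2 k : R[i], 0 <= k & forall m Phi,
  `|second_lact m Phi| <= k * `|m| * `|Phi|.
Proof.
have [k k0 kb] := second_lact_le; exists k => // m Phi.
by apply: dual_leP => [|phi]; [rewrite !mulr_ge0|exact: kb].
Qed.

Lemma second_ract_norm : exists2 k : R[i], 0 <= k & forall Phi m,
  `|second_ract Phi m| <= k * `|Phi| * `|m|.
Proof.
have [k k0 kb] := second_ract_le; exists k => // Phi m.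
by apply: dual_leP => [|phi]; [rewrite !mulr_ge0|exact: kb].
Qed.

Lemma second_lact_linearr m : linear (second_lact m).
Proof. by move=> c Phi Psi; apply: dualE. Qed.

Lemma second_ract_linearl m : linear (second_ract^~ m).
Proof. by move=> c Phi Psi; apply: dualE. Qed.

Lemma second_lact_linearl Phi : linear (second_lact^~ Phi).
Proof.
by move=> c m n; apply: dualE => phi /=; rewrite bidual_ract_linearr dual_linear.
Qed.

Lemma second_ract_linearr Phi : linear (second_ract Phi).
Proof.
by move=> c m n; apply: dualE => phi /=; rewrite bidual_lact_linearl dual_linear.
Qed.

Lemma second_lactA m n Phi :
  second_lact m (second_lact n Phi) = second_lact (arens2 m n) Phi.
Proof. by apply: dualE => phi /=; rewrite bidual_ractA. Qed.

Lemma second_ractA Phi m n :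
  second_ract (second_ract Phi m) n = second_ract Phi (arens1 m n).
Proof. by apply: dualE => phi /=; rewrite bidual_lactA. Qed.

Lemma second_lact_map_bounded m : bounded_map (second_lact m).
Proof. by have [k _ kb] := second_lact_norm; exists (k * `|m|). Qed.

Lemma second_ract_map_bounded m : bounded_map (second_ract^~ m).
Proof.
have [k _ kb] := second_ract_norm; exists (k * `|m|) => Phi.
by rewrite mulrAC.
Qed.

(** On sandwiches the transposed actions only involve the products of [m] with
    an element of [A]; this is what makes them commute there. *)
Lemma second_lact_sandwich m a a' x b : arens1 m (canon a) = canon a' ->
  second_lact m (canon (ract (lact a x) b)) = canon (ract (lact a' x) b).
Proof.
move=> ma; apply: dualE => phi /=; pose f := orbitl (dual_lact b phi) x.
rewrite -[RHS]/(canon a' f) -ma arens_canonl.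
by apply: bidual_ractE => c /=; rewrite -lractA lactA.
Qed.

Lemma second_ract_sandwich m a x b b' : arens1 (canon b) m = canon b' ->
  second_ract (canon (ract (lact a x) b)) m = canon (ract (lact a x) b').
Proof.
move=> bm; apply: dualE => phi /=; pose f := orbitr phi (lact a x).
rewrite -[RHS]/(canon b' f) -bm arens_canonr.
by apply: bidual_lactE => c /=; rewrite ractA.
Qed.

End bidual_actions.

(** * The normal bimodule of sandwiches *)

Section essential_part.
Context (R : realType) (A : banachAlgebra R) (X : banachBimodule A).

Definition sandwiches : set (dual (dual X)) :=
  [set Phi | exists a x b, Phi = canon (ract (lact a x) b)].

(** A copy of the essential part of [X], placed in the bidual of [X]: the bidual
    algebra acts there on all elements, so that its action on sums of
    sandwiches is well defined. *)
Definition essential : completeNormedModType R[i] := closed_span sandwiches.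

Lemma sandwich_in a x b :
  canon (ract (lact a x) b) \in in_closed_span sandwiches.
Proof. by apply: in_closed_span_gen; exists a, x, b. Qed.

Definition sandwich a x b : essential := ClosedSpan (sandwich_in a x b).

Lemma sandwich_linearl x b : linear (fun a => sandwich a x b).
Proof.
move=> c a a'; apply: val_inj => /=.
by rewrite lact_linearl ract_linearl canon_linear.
Qed.

Lemma sandwich_linearm a b : linear (fun x => sandwich a x b).
Proof.
move=> c x x'; apply: val_inj => /=.
by rewrite lact_linearr ract_linearl canon_linear.
Qed.

Lemma sandwich_linearr a x : linear (sandwich a x).
Proof.
by move=> c b b'; apply: val_inj => /=; rewrite ract_linearr canon_linear.
Qed.

Lemma sandwich_bounded : exists2 k : R[i], 0 <= k &
  forall a x b, `|sandwich a x b| <= k * `|a| * `|x| * `|b|.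
Proof.
have [k k0 kX] := bilinear_bound_ge0 (lact_bounded X).
have [l l0 lX] := bilinear_bound_ge0 (ract_bounded X).
exists (l * k) => [|a x b]; first by rewrite mulr_ge0.
rewrite span_norm_val/= (le_trans (canon_norm _))// (le_trans (lX _ _))//.
by rewrite ler_wpM2r// -!mulrA ler_wpM2l// mulrA.
Qed.

Lemma essential_ind (S : set essential) : closed S -> S 0 ->
  (forall (c : R[i]) x y, S x -> S y -> S (c *: x + y)) ->
  (forall a x b, S (sandwich a x b)) -> forall z, S z.
Proof.
move=> cS S0 SD Sabx; apply: closed_span_ind => // z [a [x [b zE]]].
by rewrite (_ : z = sandwich a x b)//; exact: val_inj.
Qed.

Lemma essential_dual_eq (F G : dual essential) :
  (forall a x b, F (sandwich a x b) = G (sandwich a x b)) -> F = G.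
Proof.
move=> FG; apply/eqP; rewrite -subr_eq0; apply/eqP/dualE.
apply: (essential_ind (S := dual_fun (F - G) @^-1` [set 0])).
- apply: closed_linear_preimage; first exact: dual_linear.
    by have /bounded_functionalP[] := dual_funP (F - G).
  by apply/accessible_closed_set1/hausdorff_accessible/norm_hausdorff.
- exact: linear_map0 (dual_linear (F - G)).
- move=> c x y x0 y0; apply: etrans (dual_linear (F - G) c x y) _.
  by rewrite (x0 : (F - G) x = 0) (y0 : (F - G) y = 0) scaler0 addr0.
- move=> a x b; rewrite /preimage/= -[LHS]/(F (sandwich a x b) - G (sandwich a x b)).
  by rewrite FG subrr.
Qed.

Hypothesis regA : arens_regular A.
Hypothesis idealA : ideal_in_bidual A.

Lemma second_lact_stable m Phi : Phi \in in_closed_span sandwiches ->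
  second_lact m Phi \in in_closed_span sandwiches.
Proof.
apply: closed_span_stable Phi; first exact: second_lact_linearr.
  exact: second_lact_map_bounded.
move=> _ [a [x [b ->]]]; have [[a' _ ma] _] := idealA m a.
by rewrite (second_lact_sandwich _ _ (esym ma)) sandwich_in.
Qed.

Lemma second_ract_stable m Phi : Phi \in in_closed_span sandwiches ->
  second_ract Phi m \in in_closed_span sandwiches.
Proof.
apply: (closed_span_stable (T := (@second_ract _ _ X)^~ m)) Phi.
- exact: second_ract_linearl.
- exact: second_ract_map_bounded.
move=> _ [a [x [b ->]]]; have [_ [b' _ bm]] := idealA m b.
by rewrite (second_ract_sandwich _ _ (esym bm)) sandwich_in.
Qed.

Definition essential_lact (m : bidual_algebra A) (z : essential) : essential :=
  ClosedSpan (second_lact_stable m (span_valP z)).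

Definition essential_ract (z : essential) (m : bidual_algebra A) : essential :=
  ClosedSpan (second_ract_stable m (span_valP z)).

Lemma essential_lact_sandwich m a a' x b : arens1 m (canon a) = canon a' ->
  essential_lact m (sandwich a x b) = sandwich a' x b.
Proof. by move=> ma; apply: val_inj; exact: second_lact_sandwich. Qed.

Lemma essential_ract_sandwich m a x b b' : arens1 (canon b) m = canon b' ->
  essential_ract (sandwich a x b) m = sandwich a x b'.
Proof. by move=> bm; apply: val_inj; exact: second_ract_sandwich. Qed.

(** Both sides are bounded and linear in [z] and agree on sandwiches. *)
Lemma essential_lractA m z n :
  essential_ract (essential_lact m z) n = essential_lact m (essential_ract z n).
Proof.
apply: val_inj => /=; move: (span_val z) (span_valP z).
have cl (V W U : normedModType R[i]) (f : V -> W) (g : W -> U) :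
    bounded_map f -> bounded_map g -> bounded_map (fun v => g (f v)).
  move=> /bounded_map_ge0[k k0 kf] /bounded_map_ge0[l l0 lg].
  by exists (l * k) => v; rewrite (le_trans (lg _))// -mulrA ler_wpM2l.
apply: closed_span_eq.
- by move=> c x y; rewrite second_lact_linearr second_ract_linearl.
- apply: (cl _ _ _ (second_lact m) ((@second_ract _ _ X)^~ n)).
    exact: second_lact_map_bounded.
  exact: second_ract_map_bounded.
- by move=> c x y; rewrite second_ract_linearl second_lact_linearr.
- apply: (cl _ _ _ ((@second_ract _ _ X)^~ n) (second_lact m)).
    exact: second_ract_map_bounded.
  exact: second_lact_map_bounded.
move=> _ [a [x [b ->]]].
have [[a' _ ma] _] := idealA m a; have [_ [b' _ bn]] := idealA n b.
rewrite (second_lact_sandwich _ _ (esym ma)) !(second_ract_sandwich _ _ (esym bn)).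
by rewrite (second_lact_sandwich _ _ (esym ma)).
Qed.

Definition essential_bimodule : banachBimodule (bidual_algebra A).
Proof.
refine (@BanachBimodule R (bidual_algebra A) essential essential_lact
  essential_ract _ _ _ _ _ _ essential_lractA _ _).
- by move=> z c m n; apply: val_inj; exact: second_lact_linearl.
- by move=> m c y z; apply: val_inj; exact: second_lact_linearr.
- by move=> m c y z; apply: val_inj; exact: second_ract_linearl.
- by move=> z c m n; apply: val_inj; exact: second_ract_linearr.
- by move=> m n z; apply: val_inj; rewrite /= second_lactA regA.
- by move=> z m n; apply: val_inj; exact: second_ractA.
- by have [k _ kb] := second_lact_norm X; exists k => m z; exact: kb.
- by have [k _ kb] := second_ract_norm X; exists k => z m; exact: kb.
Defined.

(** The elements [z] for which [B z] is an evaluation form a closed subspace,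
    because the evaluations at elements of [dual A] are closed in the dual of
    the bidual algebra; so it is enough to look at sandwiches. *)
Lemma range_canon_essential (B : bform essential (dual (dual A))) :
  (forall a x b, exists f : dual A, forall m, B (sandwich a x b) m = m f) ->
  forall z, exists f : dual A, forall m, B z m = m f.
Proof.
move=> Babx z.
suff : range (@canon R (dual A)) (bf_app B z).
  by move=> [f _ fE]; exists f => m; rewrite -[RHS]/(canon f m) fE.
move: z; apply: (essential_ind (S := bf_app B @^-1` range (@canon R (dual A)))).
- apply: closed_linear_preimage; first exact: bf_app_linear.
    exact: bf_app_bound.
  exact: predual_closed (bidual_predual regA).
- have := predual0 (bidual_predual regA).
  by rewrite /preimage/= (linear_map0 (bf_app_linear B)).
- move=> c x y /= xB yB; rewrite /preimage/= bf_app_linear.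
  exact: (predual_linear (bidual_predual regA)).
- move=> a x b; have [f fE] := Babx a x b; exists f => //.
  by apply: dualE => m /=; rewrite fE.
Qed.

Lemma weak_star_continuous_essential
    (T : bidual_algebra A -> dual_bimodule essential_bimodule) :
  (forall z, exists f : dual A, forall m, T m z = m f) ->
  weak_star_continuous (range (@canon R (dual A)))
    (range (@canon R essential_bimodule)) T.
Proof.
move=> TE; apply: weak_star_continuousP => _ [z _ <-].
have [f fE] := TE z.
rewrite (_ : (fun m => _) = (fun m => canon f m : R[i]^o)).
  by apply: weak_star_eval_continuous; exact: imageT.
by apply/funext => m /=; rewrite fE.
Qed.

Section sandwich_forms.
Variable zeta : dual essential.

Lemma sandwich_l_bounded x b : bounded_map (fun a => zeta (sandwich a x b)).
Proof.
have [k k0 kb] := sandwich_bounded; exists (`|zeta| * (k * `|x| * `|b|)) => a.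
rewrite (le_trans (dual_le _ _))// -[leRHS]mulrA ler_wpM2l//.
by rewrite (le_trans (kb _ _ _))// [leRHS]mulrAC [k * `|x| * _]mulrAC.
Qed.

Lemma sandwich_r_bounded a x : bounded_map (fun b => zeta (sandwich a x b)).
Proof.
have [k k0 kb] := sandwich_bounded; exists (`|zeta| * (k * `|a| * `|x|)) => b.
by rewrite (le_trans (dual_le _ _))// -[leRHS]mulrA ler_wpM2l.
Qed.

Lemma sandwich_l_linear x b : linear (fun a => zeta (sandwich a x b) : R[i]^o).
Proof. by move=> c a a'; rewrite sandwich_linearl dual_linear. Qed.

Lemma sandwich_r_linear a x : linear (fun b => zeta (sandwich a x b) : R[i]^o).
Proof. by move=> c b b'; rewrite sandwich_linearr dual_linear. Qed.

Definition sandwich_l x b : dual A :=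
  dual_of (sandwich_l_linear x b) (sandwich_l_bounded x b).

Definition sandwich_r a x : dual A :=
  dual_of (sandwich_r_linear a x) (sandwich_r_bounded a x).

End sandwich_forms.

Definition lact_form (zeta : dual essential) : bform essential (dual (dual A)).
Proof.
refine (@Bform _ _ _ (fun z m => zeta (essential_lact m z)) _ _ _).
- by move=> m c y z; rewrite -dual_linear; congr (zeta _);
    exact: (@lact_linearr _ _ essential_bimodule).
- by move=> z c m n; rewrite -dual_linear; congr (zeta _);
    exact: (@lact_linearl _ _ essential_bimodule).
- have [k k0 kb] := second_lact_norm X; exists (`|zeta| * k) => z m.
  rewrite (le_trans (dual_le _ _))// -!mulrA ler_wpM2l//.
  by rewrite [`|z| * _]mulrC mulrA; exact: kb.
Defined.

Definition ract_form (zeta : dual essential) : bform essential (dual (dual A)).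
Proof.
refine (@Bform _ _ _ (fun z m => zeta (essential_ract z m)) _ _ _).
- by move=> m c y z; rewrite -dual_linear; congr (zeta _);
    exact: (@ract_linearl _ _ essential_bimodule).
- by move=> z c m n; rewrite -dual_linear; congr (zeta _);
    exact: (@ract_linearr _ _ essential_bimodule).
- have [k k0 kb] := second_ract_norm X; exists (`|zeta| * k) => z m.
  rewrite (le_trans (dual_le _ _))// -!mulrA ler_wpM2l//.
  by rewrite mulrA; exact: kb.
Defined.

(** On a sandwich [m |-> zeta (a x (b m))] is the evaluation of [m] at [g.b],
    with [g c = zeta (a x c)], and symmetrically on the other side. *)
Lemma essential_normal :
  @normal_dual _ (bidual_dualBanachAlgebra regA) essential_bimodule.
Proof.
move=> zeta; split; apply: weak_star_continuous_essential.
  apply: (range_canon_essential (B := ract_form zeta)) => a x b.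
  exists (@ract _ _ (dual_bimodule (regular_bimodule A)) (sandwich_r zeta a x) b) => m.
  have [_ [b' _ bm]] := idealA m b.
  rewrite /= (essential_ract_sandwich _ _ (esym bm)).
  by rewrite -[LHS]/(canon b' (sandwich_r zeta a x)) bm.
apply: (range_canon_essential (B := lact_form zeta)) => a x b.
exists (@lact _ _ (dual_bimodule (regular_bimodule A)) a (sandwich_l zeta x b)) => m.
have [[a' _ ma] _] := idealA m a.
rewrite /= (essential_lact_sandwich _ _ (esym ma)).
by rewrite -[LHS]/(canon a' (sandwich_l zeta x b)) ma arens_canonl.
Qed.

End essential_part.

(** * Extending a derivation to the bidual algebra *)

Section derivation_extension.
Context (R : realType) (A : banachAlgebra R) (X : banachBimodule A).
Variables (D : A -> dual_bimodule X) (Dd : derivation D).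

Definition derivation_linear : linear D := let: And3 Dl _ _ := Dd in Dl.
Definition derivation_bounded : bounded_map D := let: And3 _ Db _ := Dd in Db.

Lemma derivationM a b x : D (ba_mul a b) x = D b (ract x a) + D a (lact b x).
Proof. by have [_ _ ->] := Dd. Qed.

Definition derivation_orbit (x : X) : dual A :=
  bf_app (op_form derivation_linear derivation_bounded) x.

Definition derivation_ext (m : dual (dual A)) : dual X :=
  bidual_ext derivation_linear derivation_bounded m.

(** The derivation rule gives [D c (a x b) = D (c a) (x b) - D a (x (b c))]; both
    terms are functionals of [c] that extend to [m]. *)
Lemma derivation_ext_sandwich m a a' x b b' :
  arens1 m (canon a) = canon a' -> arens1 (canon b) m = canon b' ->
  derivation_ext m (ract (lact a x) b) = D a' (ract x b) - D a (ract x b').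
Proof.
move=> ma bm.
pose f := derivation_orbit (ract x b).
pose g := orbitr (D a) x.
rewrite -[D a' _]/(canon a' f) -[D a _]/(canon b' g) -ma -bm.
rewrite arens_canonl arens_canonr -linearB.
apply: bidual_extE => c; rewrite /= -[LHS]/(f (ba_mul c a) - g (ba_mul b c)) /=.
by rewrite derivationM ractA lractA addrAC subrr add0r.
Qed.

Hypotheses (regA : arens_regular A) (idealA : ideal_in_bidual A).
Local Notation Z := (essential_bimodule X regA idealA).

Lemma restrict_essential_linear (phi : dual X) :
  linear (fun z : essential X => span_val z phi : R[i]^o).
Proof. by []. Qed.

Lemma restrict_essential_bounded (phi : dual X) :
  bounded_map (fun z : essential X => span_val z phi : R[i]^o).
Proof. by exists `|phi| => z; rewrite mulrC dual_le. Qed.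

(** An element of the closed span is already a functional on the dual of [X], so
    restriction is evaluation. *)
Definition restrict_essential (phi : dual X) : dual_bimodule Z :=
  dual_of (restrict_essential_linear phi) (restrict_essential_bounded phi).

Definition essential_ext (m : bidual_algebra A) : dual_bimodule Z :=
  restrict_essential (derivation_ext m).

Lemma essential_ext_sandwich m a a' x b b' :
  arens1 m (canon a) = canon a' -> arens1 (canon b) m = canon b' ->
  essential_ext m (sandwich a x b) = D a' (ract x b) - D a (ract x b').
Proof. exact: derivation_ext_sandwich. Qed.

Lemma derivation_ext_le : exists2 k : R[i], 0 <= k &
  forall m, `|derivation_ext m| <= k * `|m|.
Proof.
have [k k0 kD] := bounded_map_ge0 derivation_bounded.
by exists k => // m; exact: bidual_ext_le.
Qed.

Lemma essential_ext_linear : linear essential_ext.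
Proof.
move=> c m n; apply: dualE => z /=.
have -> : derivation_ext (c *: m + n) = c *: derivation_ext m + derivation_ext n.
  exact: bidual_ext_linear.
by rewrite dual_linear.
Qed.

Lemma essential_ext_bounded : bounded_map essential_ext.
Proof.
have [k k0 kD] := derivation_ext_le; exists k => m.
apply: dual_leP => [|z]; first by rewrite mulr_ge0.
rewrite (le_trans (dual_le (span_val z) _))// mulrC.
by apply: ler_wpM2r; [exact: normr_ge0|exact: kD].
Qed.

Definition ext_form : bform (essential X) (dual (dual A)).
Proof.
refine (@Bform _ _ _ (fun z m => essential_ext m z) _ _ _).
- by move=> m c y z; rewrite dual_linear.
- by move=> z c m n; rewrite essential_ext_linear.
- have [k k0 kD] := bounded_map_ge0 essential_ext_bounded; exists k => z m.
  by rewrite (le_trans (dual_le _ _))// mulrAC ler_wpM2r.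
Defined.

(** On the sandwich [a x b] both sides equal
    [D ((m n) a) (x b) - D a (x (b (m n)))]: the terms [D (n a) (x (b m))]
    cancel. *)
Lemma essential_ext_derivation : derivation essential_ext.
Proof.
split; [exact: essential_ext_linear|exact: essential_ext_bounded|].
move=> m n; apply: essential_dual_eq => a x b.
have [[a1 _ na] _] := idealA n a; have [[a2 _ ma] _] := idealA m a1.
have [_ [b1 _ bm]] := idealA m b; have [_ [b2 _ bn]] := idealA n b1.
rewrite -[RHS]/(essential_ext n (essential_ract idealA (sandwich a x b) m) +
  essential_ext m (essential_lact idealA n (sandwich a x b))).
rewrite (essential_ract_sandwich idealA _ _ (esym bm)).
rewrite (essential_lact_sandwich idealA _ _ (esym na)).
rewrite (essential_ext_sandwich _ (esym na) (esym bn)).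
rewrite (essential_ext_sandwich _ (esym ma) (esym bm)).
rewrite (@essential_ext_sandwich _ a a2 x b b2).
- by rewrite [RHS]addrC addrA subrK.
- by rewrite ma na; exact: (esym (@ba_mulA _ (bidual_algebra A) _ _ _)).
- by rewrite bn bm; exact: (@ba_mulA _ (bidual_algebra A)).
Qed.

Lemma essential_ext_continuous :
  weak_star_continuous (range (@canon R (dual A))) (range (@canon R Z))
    essential_ext.
Proof.
apply: weak_star_continuous_essential.
apply: (range_canon_essential regA (B := ext_form)) => a x b.
by exists (derivation_orbit (ract (lact a x) b)).
Qed.

End derivation_extension.

(** * Descending to the original bimodule *)

Section descent.
Context (R : realType) (A : banachAlgebra R) (X : banachBimodule A).
Hypotheses (regA : arens_regular A) (idealA : ideal_in_bidual A).
Variable e : dual (dual A).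
Hypothesis eP : forall m : dual (dual A), arens1 e m = m /\ arens1 m e = m.
Local Notation reg := (dual_bimodule (regular_bimodule A)).
Local Notation Z := (essential_bimodule X regA idealA).

Lemma unit_lact (f : dual A) a : e (@lact _ _ reg a f) = f a.
Proof. by rewrite -arens_canonl (eP _).1. Qed.

Lemma unit_ract (f : dual A) a : e (@ract _ _ reg f a) = f a.
Proof. by rewrite -arens_canonr (eP _).2. Qed.

Lemma sandwich_lactm a (x : X) b c : sandwich b (lact a x) c = sandwich (ba_mul b a) x c.
Proof. by apply: val_inj; rewrite /= lactA. Qed.

Lemma sandwich_ractm a (x : X) b c : sandwich b (ract x a) c = sandwich b x (ba_mul a c).
Proof. by apply: val_inj; rewrite /= -lractA ractA. Qed.

Definition descent_form (zeta : dual (essential X)) : bform X A.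
Proof.
refine (@Bform _ _ _ (fun x c => e (sandwich_l zeta x c)) _ _ _).
- move=> c k x y; rewrite -dual_linear; congr (e _); apply: dualE => b /=.
  by rewrite sandwich_linearm dual_linear.
- move=> x k c d; rewrite -dual_linear; congr (e _); apply: dualE => b /=.
  by rewrite sandwich_linearr dual_linear.
- have [k k0 kb] := sandwich_bounded X; exists (`|e| * (`|zeta| * k)) => x c.
  rewrite (le_trans (dual_le e _))// -!mulrA ler_wpM2l//.
  apply: dual_leP => [|b]; first by rewrite !mulr_ge0.
  rewrite (le_trans (dual_le zeta _))// -!mulrA ler_wpM2l//.
  by rewrite (le_trans (kb _ _ _))// -!mulrA ler_wpM2l// mulrC -!mulrA.
Defined.

(** [x |-> e (c |-> e (b |-> zeta (b x c)))]. *)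
Definition descent (zeta : dual (essential X)) : dual X :=
  contract (descent_form zeta) e.

Lemma descentE zeta x (f : dual A) :
  (forall c, f c = e (sandwich_l zeta x c)) -> descent zeta x = e f.
Proof. exact: (@contractE _ _ _ (descent_form zeta)). Qed.

Lemma descent_linear : linear descent.
Proof.
move=> k u v; apply: dualE => x.
pose f w := bf_app (descent_form w) x.
rewrite (@descentE _ x (k *: f u + f v)) ?dual_linear// => c.
rewrite -[LHS]/(k *: e (sandwich_l u x c) + e (sandwich_l v x c)) -dual_linear.
by congr (e _); apply: dualE.
Qed.

Lemma descent_bounded : bounded_map descent.
Proof.
have [k k0 kb] := sandwich_bounded X; exists (`|e| * k * `|e|) => zeta.
rewrite mulrAC; apply: contract_le => [|x c]; first by rewrite !mulr_ge0.
rewrite (le_trans (dual_le e _))// -!mulrA ler_wpM2l//.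
apply: dual_leP => [|b]; first by rewrite !mulr_ge0.
rewrite (le_trans (dual_le zeta _))// [k * _]mulrCA -!mulrA ler_wpM2l//.
by rewrite (le_trans (kb _ _ _))// -!mulrA ler_wpM2l// mulrC -!mulrA.
Qed.

(** Both sides are [e] applied to a translate, on one side or the other, of the
    functional [c |-> e (b |-> zeta (b x c))]; as [e] is an identity, both
    return its value at [a]. *)
Lemma descent_lact a (zeta : dual_bimodule Z) :
  descent (lact (canon a : bidual_algebra A) zeta) = dual_lact a (descent zeta).
Proof.
apply: dualE => x; pose h := bf_app (descent_form zeta) x.
rewrite -[RHS]/(descent zeta (ract x a)).
rewrite (@descentE _ x (@lact _ _ reg a h)) => [|c].
  rewrite (@descentE _ _ (@ract _ _ reg h a)) => [|c].
    by rewrite unit_lact unit_ract.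
  by congr (e _); apply: dualE => b /=; rewrite sandwich_ractm.
congr (e _); apply: dualE => b /=; congr (zeta _); apply/esym.
by apply: essential_ract_sandwich; exact: arens_canonM.
Qed.

Lemma descent_ract a (zeta : dual_bimodule Z) :
  descent (ract zeta (canon a : bidual_algebra A)) = dual_ract (descent zeta) a.
Proof.
apply: dualE => x.
pose h : dual A := bf_app (descent_form (ract zeta (canon a : bidual_algebra A))) x.
rewrite -[RHS]/(descent zeta (lact a x)).
rewrite (@descentE _ x h)// (@descentE _ _ h)// => c.
have -> : sandwich_l zeta (lact a x) c = @lact _ _ reg a (sandwich_l zeta x c).
  by apply: dualE => b /=; rewrite sandwich_lactm.
rewrite unit_lact -[RHS]unit_ract; congr (e _); apply: dualE => b /=.
congr (zeta _); apply: essential_lact_sandwich; exact: arens_canonM.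
Qed.

Variables (D : A -> dual_bimodule X) (Dd : derivation D).

Lemma descent_essential_ext a :
  descent (essential_ext Dd regA idealA (canon a)) =
  bidual_lact e (bidual_ract (D a) e).
Proof.
apply: dualE => x; pose f := orbitr (bidual_ract (D a) e) x.
rewrite (@bidual_lactE _ _ _ _ _ x f)//; apply: descentE => c.
apply: bidual_ractE => b /=.
by rewrite -[LHS]/(D a (ract (lact b x) c)) lractA.
Qed.

Let delta := derivation_ext Dd e.

(** In [<a.delta, x> = e (b |-> D b (x a))] replace [D b (x a)] by
    [D (a b) x - D a (b x)]; the identity [e] turns the first term into
    [D a x]. *)
Lemma lact_delta a : dual_lact a delta = D a - bidual_ract (D a) e.
Proof.
apply: dualE => x; pose F := derivation_orbit Dd x.
pose g := orbitl (D a) x.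
rewrite -[RHS]/(F a - e g) -unit_ract -linearB; apply: bidual_extE => b.
rewrite -[LHS]/(F (ba_mul a b) - g b) /=.
by rewrite derivationM// addrK.
Qed.

Lemma ract_delta a : dual_ract delta a = D a - bidual_lact e (D a).
Proof.
apply: dualE => x; pose F := derivation_orbit Dd x.
pose g := orbitr (D a) x.
rewrite -[RHS]/(F a - e g) -unit_lact -linearB; apply: bidual_extE => b.
rewrite -[LHS]/(F (ba_mul b a) - g b) /=.
by rewrite derivationM// addrAC subrr add0r.
Qed.

Lemma dual_lact_bidual_ract a phi m :
  dual_lact a (bidual_ract phi m) = bidual_ract (dual_lact a phi) m :> dual X.
Proof.
apply: dualE => x; apply: bidual_ractE => c /=.
by rewrite lractA.
Qed.

Lemma dual_ract_bidual_lact a phi m :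
  dual_ract (bidual_lact m phi) a = bidual_lact m (dual_ract phi a) :> dual X.
Proof.
apply: dualE => x; apply: bidual_lactE => c /=.
by rewrite lractA.
Qed.

Lemma bidual_lact_unit a (phi : dual X) :
  bidual_lact e (dual_lact a phi) = dual_lact a phi /\
  dual_lact a (bidual_lact e phi) = dual_lact a phi.
Proof.
by rewrite -!bidual_lact_canon !bidual_lactA (eP _).1 (eP _).2.
Qed.

Lemma dual_ract_unit a (phi : dual X) :
  dual_ract (bidual_ract phi e) a = dual_ract phi a.
Proof. by rewrite -!bidual_ract_canon bidual_ractA -regA (eP _).1. Qed.

(** Chosen so that [a.corrector = a.delta], since [a.(delta.e) = 0], and
    [corrector.a = - (delta.a)], since [(e.delta).a = 0]. *)
Definition corrector : dual X := bidual_lact e delta - bidual_ract delta e.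

(** From [a.delta = D a - (D a).e] and [delta.a = D a - e.(D a)] one gets
    [e.((D a).e) = e.(D a) - a.delta = D a - (a.delta + delta.a)], and the last
    bracket is [a.xi - xi.a] for the corrector [xi]. *)
Lemma derivation_decomposition a :
  D a = descent (essential_ext Dd regA idealA (canon a)) +
        (dual_lact a corrector - dual_ract corrector a).
Proof.
have idl phi : bidual_lact e (bidual_lact e phi) = bidual_lact e phi :> dual X.
  by rewrite bidual_lactA (eP _).1.
have idr phi : bidual_ract (bidual_ract phi e) e = bidual_ract phi e :> dual X.
  by rewrite bidual_ractA -regA (eP _).1.
have blB phi psi : bidual_lact e (phi - psi) =
    bidual_lact e phi - bidual_lact e psi :> dual X.
  exact: (zmod_morphism_linear (@bidual_lact_linearr _ _ X e)).
have brB phi psi : bidual_ract (phi - psi) e =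
    bidual_ract phi e - bidual_ract psi e :> dual X.
  exact: (zmod_morphism_linear (@bidual_ract_linearl _ _ X e)).
have -> : dual_lact a corrector = dual_lact a delta.
  have -> : dual_lact a corrector = dual_lact a (bidual_lact e delta) -
      dual_lact a (bidual_ract delta e) by exact: dualE.
  rewrite (bidual_lact_unit _ _).2 dual_lact_bidual_ract lact_delta.
  by rewrite brB idr subrr subr0.
have -> : dual_ract corrector a = - dual_ract delta a.
  have -> : dual_ract corrector a = dual_ract (bidual_lact e delta) a -
      dual_ract (bidual_ract delta e) a by exact: dualE.
  rewrite dual_ract_unit dual_ract_bidual_lact ract_delta.
  by rewrite blB idl subrr sub0r.
have -> : descent (essential_ext Dd regA idealA (canon a)) =
    bidual_lact e (D a) - dual_lact a delta.
  rewrite descent_essential_ext -[in RHS](bidual_lact_unit a delta).1 -blB.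
  by rewrite lact_delta opprB addrC subrK.
by rewrite opprK addrA subrK ract_delta addrC subrK.
Qed.

End descent.

Lemma tails_filter (I : Type) (le : I -> I -> Prop) :
  directed le -> Filter (tails le).
Proof.
move=> [[i0] _ letr ledir]; apply: filter_from_filter; first by exists i0.
move=> i j _ _; have [k ik jk] := ledir i j; exists k => // l kl.
by split; [exact: letr ik kl|exact: letr jk kl].
Qed.

Lemma approximately_amenable_of_bidual (R : realType) (A : banachAlgebra R)
    (regA : arens_regular A) : ideal_in_bidual A ->
  has_identity (bidual_algebra A) ->
  approximately_Connes_amenable (bidual_dualBanachAlgebra regA) ->
  approximately_amenable A.
Proof.
move=> idealA [e eP] amenA X D Dd.
have [I [le [zeta [dirI zetaD]]]] := amenA _ (@essential_normal _ _ X regA idealA) _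
  (essential_ext_derivation Dd regA idealA)
  (@essential_ext_continuous _ _ _ _ Dd regA idealA).
pose xi := corrector e Dd.
exists I, le, (fun i => descent e (zeta i) + xi); split=> // a.
have FF := tails_filter dirI.
rewrite (derivation_decomposition regA idealA eP Dd a).
rewrite (_ : (fun i => _) = (fun i => descent e
    (@lact _ _ (dual_bimodule (essential_bimodule X regA idealA)) (canon a) (zeta i) -
     @ract _ _ (dual_bimodule (essential_bimodule X regA idealA)) (zeta i) (canon a)) +
    (dual_lact a xi - dual_ract xi a))); last first.
  apply/funext => i.
  rewrite (zmod_morphism_linear (@descent_linear _ _ X e)).
  rewrite (descent_lact eP) (descent_ract eP).
  have -> : @lact _ _ (dual_bimodule X) a (descent e (zeta i) + xi) =
      dual_lact a (descent e (zeta i)) + dual_lact a xi by exact: dualE.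
  have -> : @ract _ _ (dual_bimodule X) (descent e (zeta i) + xi) a =
      dual_ract (descent e (zeta i)) a + dual_ract xi a by exact: dualE.
  by rewrite opprD addrACA.
apply: cvgD; last exact: cvg_cst.
apply: (cvg_comp _ _ (zetaD (canon a))).
exact: bounded_linear_continuous (@descent_linear _ _ X e) (@descent_bounded _ _ X e) _.
Qed.

Theorem theorem6p1 (R : realType) (A : banachAlgebra R)
    (regA : arens_regular A)
    (amenA : approximately_Connes_amenable (bidual_dualBanachAlgebra regA)) :
  (forall (P : set (dual A)) (predP : is_predual P),
      approximately_Connes_amenable (DualBanachAlgebra predP)) /\
  (ideal_in_bidual A -> has_identity (bidual_algebra A) ->
      approximately_amenable A).
Proof.
split=> [P predP|idealA unitA]; first exact: Connes_amenable_of_bidual amenA.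
exact: approximately_amenable_of_bidual amenA.
Qed.
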